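(* Assume that $$u_0\in D(\mathcal L^2),\qquad v_0\in D(\mathcal L),\qquad f\in C\left([0,T];D(\mathcal L^{1/2})\right)\ \text{ with } f(0)\in D(\mathcal L)$$ (so that also $w_0=f_0-q_0\mathcal L u_0\in D(\mathcal L)$). Then the sequences $\mathcal L^{1/2}(u_k-u_{k-1})/\tau$ and $\mathcal L u_k$ are locally uniformly bounded in $L^2(\Omega)$. More precisely, there exist $\overline T\in(0,T]$ and positive constants $M_3,M_4$ depending on the value of $\overline T$ (all independent of $\tau$) such that for every integer $n>1$, with $\tau=T/n$, and every solution sequence $u_0,\dots,u_n$ of the nonlinear scheme, $$\left\|\mathcal L^{1/2}\,\frac{u_k-u_{k-1}}{\tau}\right\|\le M_3,\qquad \|\mathcal L u_k\|\le M_4,\qquad 1\le k\le\left[\frac{\overline T}{\tau}\right],$$ where $[\cdot]$ denotes the integer part.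
   Context: $\Omega\subset\mathbb R^2$ is a bounded convex domain; $\|\cdot\|$ is the norm of $L^2(\Omega)$. $\mathcal L$ is the Friedrichs extension of $-\Delta$ with domain $\{u\in C^2(\overline\Omega):u|_{\partial\Omega}=0\}$, i.e. the unique self-adjoint positive definite operator in $L^2(\Omega)$ associated with the form $a(u,v)=(\nabla u,\nabla v)$ on $H^1_0(\Omega)$; $D(\mathcal L^{1/2})=H_0^1(\Omega)$, $\|\mathcal L^{1/2}u\|=\|\nabla u\|$, and powers $\mathcal L^a$, $a>0$, with their domains $D(\mathcal L^a)$ are defined by the spectral calculus. $T>0$; $\alpha,\beta\in C^1([0,T])$ are real-valued with $\min_{[0,T]}\alpha>0$ and $\min_{[0,T]}\beta>0$. For an integer $n>1$, $\tau=T/n$, $t_k=k\tau$, $\alpha_k=\alpha(t_k)$, $\beta_k=\beta(t_k)$, $f_k=f(t_k)$. The initial data are $u_0$ (initial displacement) and $v_0$ (initial velocity), and $$w_0=f_0-q_0\mathcal L u_0,\qquad q_0=\alpha_0+\beta_0\|\mathcal L^{1/2}u_0\|^2,\qquad u_1=u_0+\tau v_0+\frac{\tau^2}{2}w_0 .$$ A solution sequence of the nonlinear scheme is a sequence $u_0,\dots,u_n\in D(\mathcal L)$ with these $u_0$, $u_1$ and, for $k=1,\dots,n-1$, $$\frac{u_{k+1}-2u_k+u_{k-1}}{\tau^2}+\frac12\left(\alpha_k+\frac{\beta_k}{2}\left(\|\mathcal L^{1/2}u_{k+1}\|^2+\|\mathcal L^{1/2}u_{k-1}\|^2\right)\right)\left(\mathcal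 L u_{k+1}+\mathcal L u_{k-1}\right)=f_k .$$ *)

(* Defs.v *)
From HB Require Import structures.
From mathcomp Require Import all_boot all_order all_algebra.
From mathcomp Require Import all_classical all_reals all_analysis.

Set Implicit Arguments.
Unset Strict Implicit.
Unset Printing Implicit Defensive.
Import Order.TTheory GRing.Theory Num.Theory.
Import numFieldNormedType.Exports.
Local Open Scope classical_set_scope.
Local Open Scope ring_scope.

Lemma open_measurable2 (R : realType) (A : set (R * R)) :
  open A -> measurable A.
Proof.
move=> oA.
pose B (q : (rat * rat) * (rat * rat)) : set (R * R) :=
  `]ratr q.1.1, ratr q.1.2[%classic `*` `]ratr q.2.1, ratr q.2.2[%classic.
have -> : A = \bigcup_(q in [set q | B q `<=` A]) B q.
  apply/seteqP; split => [[x y] Axy|z [q qA]]; last exact: qA.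
  have [[/= U V] [Ux Vy] UVA] : nbhs (x, y) A by exact: open_nbhs_nbhs.
  have key (z : R) (W : set R) : nbhs z W ->
      exists2 q : rat * rat, `]ratr q.1, ratr q.2[%classic z &
        `]ratr q.1, ratr q.2[%classic `<=` W.
    move=> /nbhs_ballP[e /= e0 eW].
    have /rat_in_itvoo[p] : z - e < z by rewrite ltrBlDr ltrDl.
    rewrite in_itv/= => /andP[zp pz].
    have /rat_in_itvoo[r] : z < z + e by rewrite ltrDl.
    rewrite in_itv/= => /andP[zr rz].
    exists (p, r); first by rewrite /= in_itv/= pz.
    move=> w /=; rewrite in_itv/= => /andP[pw wr]; apply: eW.
    by rewrite /ball/= ltr_distlC (lt_trans zp pw) (lt_trans wr rz).
  have [p px pU] := key _ _ Ux; have [q qy qV] := key _ _ Vy.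
  exists (p, q) => //= z [/= /pU ? /qV ?]; exact: UVA.
rewrite bigcup_mkcond.
apply: countable_bigcupT_measurable => [|q]; first exact: countableP.
case: ifP => // _; by apply: measurableX; exact: measurable_itv.
Qed.

Record convex_domain (R : realType) := ConvexDomain {
  dom_set :> set (R * R) ;
  dom_nonempty : dom_set !=set0 ;
  dom_open : open dom_set ;
  dom_bounded : bounded_set dom_set ;
  dom_convex : convex_set (dom_set : set (convex_lmodType (R * R)%type)) }.

Section operators.
Context {R : realType} (Om : convex_domain R).

Definition mu2 :
    {measure set (measurableTypeR R * measurableTypeR R) -> \bar R} :=
  mrestr (lebesgue_measure \x lebesgue_measure)%E
    (open_measurable2 (@dom_open R Om)).

(* Elements are functions, not classes: equality in L^2(Om) is equality
   almost everywhere for [mu2]. *)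
Definition L2 := LfunType mu2 (lee1n 2).

Definition eqL2 (u v : L2) : Prop := (u : R * R -> R) = v %[ae mu2].

Definition dot (u v : L2) : R := \int[mu2]_x (u x * v x).

Definition norm2 (u : L2) : R := fine ('N[mu2]_2%:E[EFin \o u])%E.

Definition e1 : R * R := (1, 0).
Definition e2 : R * R := (0, 1).

Fixpoint Ck (k : nat) (phi : R * R -> R) : Prop :=
  if k is k'.+1 then
    continuous phi /\ forall e, e = e1 \/ e = e2 ->
      (forall x, derivable phi x e) /\ Ck k' ('D_e phi)
  else continuous phi.

(* phi in C_c^oo(Om) *)
Definition test_function (phi : R * R -> R) : Prop :=
  (forall k, Ck k phi) /\
  exists K : set (R * R),
    [/\ compact K, K `<=` Om & forall x, ~ K x -> phi x = 0].

Definition weak_partial (e : R * R) (u g : L2) : Prop :=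
  forall phi, test_function phi ->
    \int[mu2]_x (u x * 'D_e phi x) = - \int[mu2]_x (g x * phi x).

Definition L2close (u : L2) (phi : R * R -> R) (eps : R) : Prop :=
  ('N[mu2]_2%:E[EFin \o (fun x => u x - phi x)%R] < eps%:E)%E.

(* u in H^1_0(Om), the closure of C_c^oo(Om) in H^1(Om), with weak gradient
   (G.1, G.2). *)
Definition H10 (u : L2) (G : L2 * L2) : Prop :=
  [/\ weak_partial e1 u G.1, weak_partial e2 u G.2 &
    forall eps, 0 < eps -> exists2 phi, test_function phi &
      [/\ L2close u phi eps, L2close G.1 ('D_e1 phi) eps
        & L2close G.2 ('D_e2 phi) eps]].

(* u in D(L) and L u = g, where L is the Friedrichs extension of the Dirichlet
   -Laplacian, i.e. the operator of the form (grad u, grad v) on H^1_0. *)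
Definition isL (u g : L2) : Prop :=
  exists2 G, H10 u G &
    forall v V, H10 v V -> dot G.1 V.1 + dot G.2 V.2 = dot g v.

Definition domL (u : L2) : Prop := exists g, isL u g.

(* The value of L on D(L), up to a.e. equality; 0 outside D(L). *)
Definition opL (u : L2) : L2 := xget 0 [set g | isL u g].

(* Projection-valued measure on the Borel sets of R, carried by [0, +oo[;
   [sp_mu u] is the measure A |-> (P(A) u, u), whose being a measure is the
   countable additivity of P. *)
Record spectral_measure := SpectralMeasure {
  sp_proj : set R -> L2 -> L2 ;
  sp_mu : L2 -> {measure set R -> \bar R} ;
  sp_linear : forall A, measurable A -> forall (a : R) u v,
    eqL2 (sp_proj A (a *: u + v)) (a *: sp_proj A u + sp_proj A v) ;
  sp_sym : forall A, measurable A -> forall u v,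
    dot (sp_proj A u) v = dot u (sp_proj A v) ;
  sp_mul : forall A B, measurable A -> measurable B -> forall u,
    eqL2 (sp_proj (A `&` B) u) (sp_proj A (sp_proj B u)) ;
  sp_full : forall u, eqL2 (sp_proj `[0, +oo[%classic u) u ;
  sp_muE : forall A, measurable A -> forall u,
    sp_mu u A = (dot (sp_proj A u) u)%:E }.

Definition sp_dom (E : spectral_measure) (a : R) (u : L2) : Prop :=
  (\int[sp_mu E u]_(l in `[0%R, +oo[) (l `^ (2 * a))%:E < +oo)%E.

(* u in D(A) and A u = g for A = \int l^a dE(l), where the integral against
   A |-> (P(A) u, v) is written by polarization. *)
Definition sp_pow (E : spectral_measure) (a : R) (u g : L2) : Prop :=
  sp_dom E a u /\
  forall v, sp_dom E a v ->
    dot g v = 4^-1 * (\int[sp_mu E (u + v)]_(l in `[0, +oo[) (l `^ a)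
                      - \int[sp_mu E (u - v)]_(l in `[0, +oo[) (l `^ a)).

Definition resolves_L (E : spectral_measure) : Prop :=
  forall u g, isL u g <-> sp_pow E 1 u g.

(* u in D(L^a) and L^a u = g. By uniqueness of the spectral measure of L, up to
   a.e. equality of the [sp_proj A u], the choice of E is immaterial. *)
Definition isLpow (a : R) (u g : L2) : Prop :=
  exists2 E, resolves_L E & sp_pow E a u g.

Definition domLpow (a : R) (u : L2) : Prop := exists g, isLpow a u g.

Definition opLpow (a : R) (u : L2) : L2 := xget 0 [set g | isLpow a u g].

(* f in C([0,T]; D(L^a)) for the graph norm of D(L^a). *)
Definition continuous_domLpow (a T : R) (f : R -> L2) : Prop :=
  {in `[0, T], forall t, domLpow a (f t)} /\
  {in `[0, T], forall t,
     norm2 (f s - f t) @[s --> within `[0, T]%classic (nbhs t)] --> (0 : R) /\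
     norm2 (opLpow a (f s - f t))
       @[s --> within `[0, T]%classic (nbhs t)] --> (0 : R)}.

End operators.

(* C^1([0,T]): C^1 inside, with a derivative extending continuously to the
   endpoints. *)
Definition C1_itv (R : realType) (T : R) (a : R -> R) : Prop :=
  {within `[0, T], continuous a} /\
  exists2 a' : R -> R, {within `[0, T], continuous a'} &
    {in `]0, T[, forall t : R, is_derive t 1 a (a' t)}.

Section scheme.
Context {R : realType} (Om : convex_domain R).
Variables (T : R) (alpha beta : R -> R) (f : R -> L2 Om) (u0 v0 : L2 Om).

Definition w0 : L2 Om :=
  f 0 - (alpha 0 + beta 0 * norm2 (opLpow 2^-1 u0) ^+ 2) *: opL u0.

Definition first_step (tau : R) : L2 Om :=
  u0 + tau *: v0 + (tau ^+ 2 / 2) *: w0.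

Definition scheme_step (tau t : R) (um u up : L2 Om) : Prop :=
  eqL2 ((tau ^- 2) *: (up - 2 *: u + um)
        + (2^-1 * (alpha t + beta t / 2 *
             (norm2 (opLpow 2^-1 up) ^+ 2 + norm2 (opLpow 2^-1 um) ^+ 2)))
          *: (opL up + opL um))
       (f t).

(* Only the terms u 0, ..., u n matter. *)
Definition solution_sequence (n : nat) (u : nat -> L2 Om) : Prop :=
  let tau := T / n%:R in
  [/\ forall k, (k <= n)%N -> domL (u k),
      eqL2 (u 0%N) u0,
      eqL2 (u 1%N) (first_step tau) &
      forall k, (1 <= k < n)%N ->
        scheme_step tau (k%:R * tau) (u k.-1) (u k) (u k.+1)].

End scheme.

(* Main.v *)
Require Import Defs.
From mathcomp Require Import all_boot all_order all_algebra.
From mathcomp Require Import all_classical all_reals all_analysis.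
From mathcomp Require Import measurable_realfun ring lra.
Import Order.TTheory GRing.Theory Num.Theory.
Import numFieldNormedType.Exports.
Set Implicit Arguments.
Unset Strict Implicit.
Unset Printing Implicit Defensive.
Local Open Scope classical_set_scope.
Local Open Scope ring_scope.

(** Write [d_k = (u_k - u_(k-1)) / tau] and [|v|_1 = |L^(1/2) v|]. Pairing the
    scheme with [L (u_(k+1) - u_(k-1))] gives the identity
      [|d_(k+1)|_1^2 - |d_k|_1^2 + q_k / 2 (|L u_(k+1)|^2 - |L u_(k-1)|^2)
        = (f_k, L (u_(k+1) - u_(k-1)))],
    where [q_k = alpha_k + beta_k / 2 (|u_(k+1)|_1^2 + |u_(k-1)|_1^2)]
    ([scheme_step_energy]). Hence the energy
      [E_k = |d_(k+1)|_1^2 + q_k / 2 (|L u_(k+1)|^2 + |L u_k|^2)]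
    grows only through the increment of [q_k] and through [f_k]. Both
    contributions are of order [tau], with factors that depend on a bound for
    the energies up to [E_k] itself: [q_k] varies because of [alpha], [beta],
    which are Lipschitz, and because
      [| |u_(k+1)|_1 - |u_k|_1 | <= tau |d_(k+1)|_1].
    This nonlinear inequality closes for small times only; on such an interval
    a bootstrap keeps the energy within distance one of its initial bound
    ([discrete_bound_local]), and since [alpha] is bounded below by a positive
    constant, the energy controls both norms of the statement.

    The operator theory behind this is read off from one spectral measure [E] of
    [L], which the domain hypotheses provide. Step functions of [L], that is,
    finite combinations of spectral projections, converge strongly on the domain
    of the power they approximate, by monotone convergence and the completeness
    of L^2 ([step_op_is_cvgL2], [L2_complete]), and the limit is the weakly
    defined power ([sp_pow_cvgL2]). Therefore [L] is linear, symmetric and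
    nonnegative on its domain, [|v|_1^2 = (L v, v)] there, and
    [(g, L h) = (L^(1/2) g, L^(1/2) h)] ([sp_pow_half_one]).

    The function [opLpow] may pick different spectral measures for different
    vectors. This is harmless because the half power enters through two
    quantities that [L] alone determines: the form [(L v, v)], and the least [C]
    with [|(g, L h)| <= C (L h, h)^(1/2)] for all [h] in D(L). Finiteness of the
    latter characterizes D(L^(1/2)) for every spectral measure of [L]
    ([half_bounded_sp_dom]), so D(L^(1/2)) is a vector space, the graph-norm
    continuity of [f] has content, and compactness of the time interval bounds
    [f_k] uniformly ([half_bounded_uniform]). *)

(** * Functions of class C^1 on a segment *)

Lemma segment_bounded (R : realType) (T : R) (a : R -> R) : 0 < T ->
  {within `[0, T], continuous a} ->
  exists2 M, 0 < M & forall t, t \in `[0, T] -> `|a t| <= M.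
Proof.
move=> T0 ca.
have [s sT hs] := EVT_max (ltW T0) ca.
have [r rT hr] := EVT_min (ltW T0) ca.
exists (`|a s| + `|a r| + 1); first by rewrite ltr_wpDl// addr_ge0.
move=> t tT; have := hs t tT; have := hr t tT.
have := ler_norm (a s); have := ler_norm (- a r); rewrite normrN.
have := normr_ge0 (a s); have := normr_ge0 (a r).
by rewrite ler_norml => *; apply/andP; split; lra.
Qed.

Lemma C1_itv_lipschitz (R : realType) (T : R) (a : R -> R) : 0 < T ->
  C1_itv T a -> exists2 M, 0 < M &
    forall s t, s \in `[0, T] -> t \in `[0, T] -> `|a t - a s| <= M * `|t - s|.
Proof.
move=> T0 [ca [a' ca' da]].
have [M M0 hM] := segment_bounded T0 ca'.
exists M => // s t.
wlog st : s t / s <= t => [hw sT tT|].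
  have [st|/ltW ts] := leP s t; first exact: hw.
  by rewrite distrC (distrC t); exact: hw.
rewrite !in_itv/= => /andP[s0 sT] /andP[t0 tT].
have [x xst ->] : exists2 x, x \in `[s, t] & a t - a s = a' x * (t - s).
  apply: (@MVT_segment _ a a') => // [x|].
    rewrite in_itv/= => /andP[sx xt]; apply: da.
    by rewrite in_itv/= (le_lt_trans s0 sx) (lt_le_trans xt tT).
  apply: continuous_subspaceW ca => x /=; rewrite !in_itv/= => /andP[sx xt].
  by rewrite (le_trans s0 sx) (le_trans xt tT).
rewrite normrM ler_wpM2r// hM//.
by move: xst; rewrite !in_itv/= => /andP[sx xt];
  rewrite (le_trans s0 sx) (le_trans xt tT).
Qed.

Lemma segment_pos_lower (R : realType) (T : R) (a : R -> R) : 0 < T ->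
  {within `[0, T], continuous a} -> {in `[0, T], forall t, 0 < a t} ->
  exists2 m, 0 < m & forall t, t \in `[0, T] -> m <= a t.
Proof.
move=> T0 ca pa; have [r rT hr] := EVT_min (ltW T0) ca.
by exists (a r) => //; exact: pa.
Qed.

(** * The discrete energy inequality *)

Section discrete_energy.
Variable R : realFieldType.

(** Lipschitz constant in time of the coefficient [q_k], as long as the
    positions are bounded by [P] and the earlier velocities by [K]. *)
Definition coef_lip (A B b1 T K P : R) : R :=
  A + B * (2 * P ^+ 2 + T ^+ 2) + b1 * (P + T + K * P).

Lemma coef_lip_ge0 (A B b1 T K P : R) : 0 <= A -> 0 <= B -> 0 <= b1 ->
  0 <= T -> 0 <= K -> 0 <= P -> 0 <= coef_lip A B b1 T K P.
Proof.
move=> A0 B0 b10 T0 K0 P0.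
have h1 : 0 <= 2 * P ^+ 2 + T ^+ 2 by rewrite addr_ge0 ?mulr_ge0 ?sqr_ge0.
have h2 : 0 <= P + T + K * P by rewrite !addr_ge0 ?mulr_ge0.
by rewrite /coef_lip !addr_ge0 ?mulr_ge0.
Qed.

(** The unknown velocity [x] enters quadratically, because the new position [p3]
    is only known to be at most [P + tau * x]. *)
Lemma coef_increment (A B b1 T K P tau a a' b b' p0 p1 p2 p3 x : R) :
  0 <= A -> 0 <= B -> 0 <= K -> 0 <= tau <= T -> 0 <= x ->
  `|a' - a| <= A * tau -> `|b' - b| <= B * tau -> 0 <= b <= b1 ->
  0 <= p0 <= P -> 0 <= p1 <= P -> 0 <= p2 <= P -> 0 <= p3 ->
  `|p3 - p2| <= tau * x -> `|p1 - p0| <= tau * K ->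
  (a' + b' / 2 * (p3 ^+ 2 + p1 ^+ 2)) - (a + b / 2 * (p2 ^+ 2 + p0 ^+ 2))
    <= tau * (coef_lip A B b1 T K P * (1 + x ^+ 2)).
Proof.
move=> A0 B0 K0 /andP[tau0 tauT] x0 /ler_normlP[_ ha] /ler_normlP[_ hb].
move=> /andP[b0 bb1] /andP[p00 p0P] /andP[p10 p1P] /andP[p20 p2P] p30.
move=> /ler_normlP[_ h32] /ler_normlP[_ h10].
have P0 : 0 <= P by exact: le_trans p0P.
have T0 : 0 <= T by exact: le_trans tauT.
have b10 : 0 <= b1 by exact: le_trans bb1.
have txT : tau * x <= T * x by exact: ler_wpM2r.
have tx0 : 0 <= tau * x by exact: mulr_ge0.
have p3P : p3 <= P + T * x by lra.
have p3s : p3 ^+ 2 <= 2 * P ^+ 2 + 2 * (T ^+ 2 * x ^+ 2).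
  have : p3 ^+ 2 <= (P + T * x) ^+ 2 by rewrite ler_pXn2r ?nnegrE ?addr_ge0
    ?mulr_ge0.
  by have := sqr_ge0 (P - T * x); rewrite !expr2; lra.
have p1s : p1 ^+ 2 <= P ^+ 2 by rewrite ler_pXn2r ?nnegrE.
have sB : (b' - b) * (p3 ^+ 2 + p1 ^+ 2) <=
    B * tau * (3 * P ^+ 2 + 2 * (T ^+ 2 * x ^+ 2)).
  apply: le_trans (_ : B * tau * (p3 ^+ 2 + p1 ^+ 2) <= _).
    by apply: ler_wpM2r => //; rewrite addr_ge0 ?sqr_ge0.
  by apply: ler_wpM2l; [exact: mulr_ge0|lra].
have s32 : p3 ^+ 2 - p2 ^+ 2 <= tau * ((P + T) * (1 + x ^+ 2)).
  rewrite subr_sqr; apply: (@le_trans _ _ (tau * x * (2 * P + T * x))).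
    apply: (@le_trans _ _ (tau * x * (p3 + p2))).
      by apply: ler_wpM2r => //; exact: addr_ge0.
    by apply: ler_wpM2l => //; lra.
  rewrite -mulrA; apply: ler_wpM2l => //.
  have := mulr_ge0 P0 (sqr_ge0 (1 - x)); rewrite !expr2; lra.
have s10 : p1 ^+ 2 - p0 ^+ 2 <= tau * (2 * (K * P)).
  rewrite subr_sqr; apply: (@le_trans _ _ (tau * K * (p1 + p0))).
    by apply: ler_wpM2r => //; exact: addr_ge0.
  rewrite -mulrA; apply: ler_wpM2l => //.
  by have := ler_wpM2l K0 (lerD p1P p0P); lra.
have x20 := sqr_ge0 x.
have s : b * (p3 ^+ 2 - p2 ^+ 2 + (p1 ^+ 2 - p0 ^+ 2)) <=
    b1 * (tau * ((P + T) * (1 + x ^+ 2) + 2 * (K * P))).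
  apply: (@le_trans _ _ (b * (tau * ((P + T) * (1 + x ^+ 2) + 2 * (K * P))))).
    by apply: ler_wpM2l => //; lra.
  apply: ler_wpM2r => //; apply: mulr_ge0 => //.
  by rewrite addr_ge0 ?mulr_ge0 ?addr_ge0.
rewrite /coef_lip.
have e1 : 0 <= A * tau * x ^+ 2 by rewrite !mulr_ge0.
have e2 : 0 <= B * tau * (P ^+ 2 + 2 * T ^+ 2 + 4 * P ^+ 2 * x ^+ 2).
  by rewrite mulr_ge0 ?mulr_ge0 ?addr_ge0 ?mulr_ge0 ?sqr_ge0.
have e3 : 0 <= b1 * tau * ((P + T) * (1 + x ^+ 2) + 2 * (K * P) * x ^+ 2).
  by rewrite mulr_ge0 ?mulr_ge0 ?addr_ge0 ?mulr_ge0 ?addr_ge0.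
lra.
Qed.

(** At [k = 0] the convention [0.-1 = 0] acts as a fictitious previous term
    equal to the initial one, so the first step needs no separate treatment. *)
Definition coef (al be p : nat -> R) k : R :=
  al k + be k / 2 * (p k.+1 ^+ 2 + p k.-1 ^+ 2).

Definition energy (al be x y p : nat -> R) k : R :=
  x k.+1 ^+ 2 + coef al be p k / 2 * (y k.+1 ^+ 2 + y k ^+ 2).

(** The scalar content of the scheme: [x k] stands for the velocity in the form
    seminorm, [y k] for the norm of [L u_k] and [p k] for the form seminorm of
    [u_k]. *)
Record discrete_bound (n : nat) (tau a0 a1 A B b1 F X Y P0 : R)
    (al be x y p : nat -> R) : Prop := DiscreteBound {
  db_x : forall k, 0 <= x k ;
  db_y : forall k, 0 <= y k ;
  db_p : forall k, 0 <= p k ;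
  db_al : forall k, (k <= n)%N -> a0 <= al k <= a1 ;
  db_be : forall k, (k <= n)%N -> 0 <= be k <= b1 ;
  db_al_lip : forall k, (k < n)%N -> `|al k.+1 - al k| <= A * tau ;
  db_be_lip : forall k, (k < n)%N -> `|be k.+1 - be k| <= B * tau ;
  db_p_lip : forall k, (k < n)%N -> `|p k.+1 - p k| <= tau * x k.+1 ;
  db_step : forall k, (1 <= k < n)%N ->
    x k.+1 ^+ 2 - x k ^+ 2
      + coef al be p k / 2 * (y k.+1 ^+ 2 - y k.-1 ^+ 2)
      <= tau * (F * (x k.+1 + x k)) ;
  db_x1 : x 1%N <= X ;
  db_y0 : y 0%N <= Y ;
  db_y1 : y 1%N <= Y ;
  db_p0 : p 0%N <= P0 }.

Section bound.
Variables (n : nat) (T tau a0 a1 A B b1 F X Y P0 : R).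
Variables (al be x y p : nat -> R).
Hypothesis db : discrete_bound n tau a0 a1 A B b1 F X Y P0 al be x y p.
Hypotheses (tau0 : 0 <= tau) (a00 : 0 < a0) (A0 : 0 <= A) (B0 : 0 <= B).
Hypotheses (F0 : 0 <= F).

Local Notation E := (energy al be x y p).
Local Notation q := (coef al be p).

Lemma coef_ge k : (k <= n)%N -> a0 <= q k.
Proof.
move=> kn; have /andP[ha _] := db_al db kn; have /andP[hb _] := db_be db kn.
by rewrite /coef ler_wpDr// mulr_ge0 ?divr_ge0 ?addr_ge0 ?sqr_ge0.
Qed.

Lemma energy_ge k : (k <= n)%N ->
  x k.+1 ^+ 2 + a0 / 2 * (y k.+1 ^+ 2 + y k ^+ 2) <= E k.
Proof.
move=> kn; rewrite /energy lerD2l ler_wpM2r ?addr_ge0 ?sqr_ge0//.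
by rewrite ler_pM2r ?invr_gt0// coef_ge.
Qed.

Lemma energy_le_x k K : 1 <= K -> (k <= n)%N -> E k <= K -> x k.+1 <= K.
Proof.
move=> K1 kn EK; have h := energy_ge kn.
have h2 : 0 <= a0 / 2 * (y k.+1 ^+ 2 + y k ^+ 2).
  by rewrite mulr_ge0 ?addr_ge0 ?sqr_ge0 ?divr_ge0// ltW.
have [x1|x1] := lerP (x k.+1) 1; first exact: le_trans K1.
have : x k.+1 * 1 <= x k.+1 * x k.+1 by rewrite ler_wpM2l ?(db_x db)// ltW.
by rewrite -expr2; lra.
Qed.

(** Replacing [q k] by [q k.-1] in the energy costs the increment of the
    coefficient times [y k ^+ 2 + y k.-1 ^+ 2], which the previous energy
    controls by the lower bound [a0] of the coefficient. *)
Lemma energy_step (k : nat) (K : R) : tau <= T -> 1 <= K -> (1 <= k < n)%N ->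
  (forall j, (j < k)%N -> E j <= K) ->
  (forall j, (j <= k)%N -> p j <= P0 + T * K) ->
  E k <= E k.-1 + tau * ((K / a0 * coef_lip A B b1 T K (P0 + T * K) + F * (1 +
    K))
                          * (1 + x k.+1 ^+ 2)).
Proof.
move=> tauT K1 /andP[k1 kn] EK pP; set P := P0 + T * K in pP *.
case: k k1 kn EK pP => // k _ kn EK pP /=.
have K0 : 0 <= K by exact: le_trans K1.
have xk : x k.+1 <= K by apply: energy_le_x => //;
  [exact: ltnW (ltnW _)|exact: EK].
have p2P : p k.-1 <= P by apply: pP; exact: leq_trans (leq_pred k) (leqnSn k).
have h10 : `|p k - p k.-1| <= tau * K.
  case: k kn EK pP xk p2P => [|k] kn EK pP xk p2P /=.
    by rewrite subrr normr0 mulr_ge0.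
  apply: le_trans (db_p_lip db _) _; first exact: ltnW (ltnW kn).
  apply: ler_wpM2l => //; apply: energy_le_x => //.
    exact: ltnW (ltnW (ltnW kn)).
  exact: EK.
have hq : q k.+1 - q k <= tau * (coef_lip A B b1 T K P * (1 + x k.+2 ^+ 2)).
  rewrite /coef /=; apply: coef_increment => //.
  - by rewrite tau0 tauT.
  - exact: (db_x db).
  - by apply: (db_al_lip db); exact: ltnW kn.
  - by apply: (db_be_lip db); exact: ltnW kn.
  - by apply: (db_be db); exact: ltnW (ltnW kn).
  - by rewrite (db_p db).
  - by rewrite (db_p db) pP.
  - by rewrite (db_p db) pP.
  - exact: (db_p db).
  - exact: (db_p_lip db).
have hy : (y k.+1 ^+ 2 + y k ^+ 2) / 2 <= K / a0.
  rewrite ler_pdivlMr//; have := energy_ge (ltnW (ltnW kn));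
    have := EK _ (ltnSn k).
  have := sqr_ge0 (x k.+1); lra.
have y0 : 0 <= (y k.+1 ^+ 2 + y k ^+ 2) / 2 by rewrite divr_ge0 ?addr_ge0
  ?sqr_ge0.
have C10 : 0 <= tau * (coef_lip A B b1 T K P * (1 + x k.+2 ^+ 2)).
  have P00 : 0 <= P by apply: le_trans (pP 0%N isT); exact: (db_p db).
  have T0 : 0 <= T by exact: le_trans tauT.
  have b10 : 0 <= b1.
    by have /andP[b0 b01] := db_be db (leq0n n); exact: le_trans b01.
  apply: mulr_ge0 => //; apply: mulr_ge0; first exact: coef_lip_ge0.
  by rewrite addr_ge0 ?sqr_ge0.
have h1 : (q k.+1 - q k) * ((y k.+1 ^+ 2 + y k ^+ 2) / 2) <=
    tau * (coef_lip A B b1 T K P * (1 + x k.+2 ^+ 2)) * (K / a0).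
  apply: (@le_trans _ _ (tau * (coef_lip A B b1 T K P * (1 + x k.+2 ^+ 2)) *
     ((y k.+1 ^+ 2 + y k ^+ 2) / 2))); first exact: ler_wpM2r.
  exact: ler_wpM2l.
have h2 : tau * (F * (x k.+2 + x k.+1)) <=
    tau * (F * ((1 + K) * (1 + x k.+2 ^+ 2))).
  apply: ler_wpM2l => //; apply: ler_wpM2l => //.
  have := sqr_ge0 (x k.+2 - 1); have := mulr_ge0 K0 (sqr_ge0 (x k.+2)).
  have := sqr_ge0 (x k.+2).
  rewrite !expr2; lra.
have h3 := db_step db (k := k.+1) kn; rewrite /= in h3.
rewrite /energy.
move: h1 h2 h3; set C1 := coef_lip _ _ _ _ _ _.
move: (q k.+1) (q k) (K / a0) => q1 q0 W h1 h2 h3.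
lra.
Qed.

Lemma position_le (k : nat) (K : R) : tau <= T -> k%:R * tau <= T -> 1 <= K ->
  (k <= n)%N -> (forall j, (j < k)%N -> E j <= K) ->
  forall j, (j <= k)%N -> p j <= P0 + T * K.
Proof.
move=> tauT kT K1 kn EK j jk; have K0 : 0 <= K by exact: le_trans K1.
apply: (@le_trans _ _ (P0 + j%:R * tau * K)); last first.
  rewrite lerD2l ler_wpM2r//; apply: le_trans kT.
  by rewrite ler_wpM2r// ler_nat.
elim: j jk => [_|j ih jk]; first by rewrite !mul0r addr0 (db_p0 db).
have /ler_normlP[_] := db_p_lip db (leq_trans jk kn).
have := ih (ltnW jk).
have xK : x j.+1 <= K.
  apply: energy_le_x => //; last exact: EK.
  exact: leq_trans (ltnW jk) kn.
have := ler_wpM2l tau0 xK; rewrite -natr1; lra.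
Qed.

Lemma energy0_le : tau <= T -> (0 < n)%N ->
  E 0 <= X ^+ 2 + (a1 + b1 * (P0 + T * X) ^+ 2) * Y ^+ 2.
Proof.
move=> tauT n0.
have x0 := db_x db; have y0 := db_y db; have p0 := db_p db.
have X0 : 0 <= X by apply: le_trans (db_x1 db).
have Y0 : 0 <= Y by apply: le_trans (db_y1 db).
have T0 : 0 <= T by exact: le_trans tauT.
have p1 : p 1%N <= P0 + T * X.
  have /ler_normlP[_] := db_p_lip db n0; have := db_p0 db.
  have : tau * x 1%N <= T * X by rewrite ler_pM// (db_x1 db).
  lra.
have p0' : p 0%N <= P0 + T * X by rewrite ler_wpDr ?mulr_ge0 ?(db_p0 db).
have P0' : 0 <= P0 + T * X by exact: le_trans p1.
have p1s : p 1%N ^+ 2 <= (P0 + T * X) ^+ 2 by rewrite ler_pXn2r ?nnegrE.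
have p0s : p 0%N ^+ 2 <= (P0 + T * X) ^+ 2 by rewrite ler_pXn2r ?nnegrE.
have x1s : x 1%N ^+ 2 <= X ^+ 2 by rewrite ler_pXn2r ?nnegrE ?(db_x1 db).
have y1s : y 1%N ^+ 2 <= Y ^+ 2 by rewrite ler_pXn2r ?nnegrE ?(db_y1 db).
have y0s : y 0%N ^+ 2 <= Y ^+ 2 by rewrite ler_pXn2r ?nnegrE ?(db_y0 db).
have /andP[_ ha] := db_al db (leq0n n); have /andP[b0 hb] := db_be db (leq0n n).
have hq : q 0 <= a1 + b1 * (P0 + T * X) ^+ 2.
  rewrite /coef /=.
  have : be 0%N * ((p 1%N ^+ 2 + p 0%N ^+ 2) / 2) <= b1 * (P0 + T * X) ^+ 2.
    by apply: ler_pM => //; [rewrite divr_ge0 ?addr_ge0 ?sqr_ge0|lra].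
  lra.
rewrite /energy.
have : q 0 * ((y 1%N ^+ 2 + y 0%N ^+ 2) / 2) <=
    (a1 + b1 * (P0 + T * X) ^+ 2) * Y ^+ 2.
  apply: ler_pM => //; last by lra.
  - by apply: le_trans (coef_ge (leq0n n)); exact: ltW.
  - by rewrite divr_ge0 ?addr_ge0 ?sqr_ge0.
lra.
Qed.

End bound.

(** The increment bound is quadratic in the unknown [x k.+1], but with a factor
    [tau]; for small times this is absorbed, and a bootstrap keeps the energy
    within distance 1 of its initial bound. *)
Lemma discrete_bound_local (T a0 a1 A B b1 F X Y P0 : R) :
  0 < T -> 0 < a0 -> 0 <= a1 -> 0 <= A -> 0 <= B -> 0 <= b1 -> 0 <= F ->
  0 <= P0 ->
  exists Tbar M, [/\ 0 < Tbar <= T, 0 < M &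
    forall n tau al be x y p,
      discrete_bound n tau a0 a1 A B b1 F X Y P0 al be x y p ->
      0 < tau -> n%:R * tau = T ->
      forall k, (1 <= k <= n)%N -> k%:R * tau <= Tbar -> x k <= M /\ y k <= M].
Proof.
move=> T0 a00 a10 A0 B0 b10 F0 P00.
pose K0 := X ^+ 2 + (a1 + b1 * (P0 + T * X) ^+ 2) * Y ^+ 2.
have K00 : 0 <= K0.
  apply: addr_ge0; first exact: sqr_ge0.
  apply: mulr_ge0; last exact: sqr_ge0.
  by apply: addr_ge0 => //; apply: mulr_ge0 => //; exact: sqr_ge0.
pose K := K0 + 1; have K1 : 1 <= K by rewrite ler_wpDl.
have Kpos : 0 < K by exact: lt_le_trans K1.
pose C0 := K / a0 * coef_lip A B b1 T K (P0 + T * K) + F * (1 + K).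
have T0w := ltW T0; have Kw := ltW Kpos; have a0w := ltW a00.
have C00 : 0 <= C0.
  have lip0 : 0 <= coef_lip A B b1 T K (P0 + T * K).
    by apply: coef_lip_ge0 => //; rewrite addr_ge0 ?mulr_ge0.
  apply: addr_ge0; apply: mulr_ge0 => //; first exact: divr_ge0.
  exact: addr_ge0.
pose C := C0 + 1; have Cpos : 0 < C by rewrite ltr_wpDl.
(* Times up to [D^-1] make [tau * C <= 1 / 2], which absorbs the quadratic term
   and gives [x k.+1 ^+ 2 <= 2 * K + 2]; the energy then grows by at most
   [1 / 2] in total. *)
pose D := 2 * (C * (3 + 2 * K)).
have K3 : 0 < 3 + 2 * K by lra.
have Dpos : 0 < D by apply: mulr_gt0 => //; exact: mulr_gt0.
pose M := K + 2 * K / a0 + 1.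
exists (Num.min T D^-1), M; split.
- by rewrite lt_min T0 invr_gt0 Dpos ge_min lexx.
- have : 0 < 2 * K / a0 by apply: divr_gt0 => //; exact: mulr_gt0.
  by rewrite /M; lra.
move=> n tau al be x y p db tau0 nT.
have T0' := ltW tau0.
have claim k : (k < n)%N -> k.+1%:R * tau <= Num.min T D^-1 ->
    energy al be x y p k <= K0 + k%:R * tau * (C * (3 + 2 * K)).
  elim/ltn_ind: k => k ih kn; rewrite le_min => /andP[kT kD].
  have tk : tau <= k.+1%:R * tau by rewrite ler_peMl// ler1n.
  have tauT : tau <= T by exact: le_trans kT.
  have small j : (j <= k.+1)%N -> j%:R * tau * (C * (3 + 2 * K)) <= 2^-1.
    move=> jk; have : j%:R * tau <= D^-1.
      by apply: le_trans kD; rewrite ler_wpM2r// ler_nat.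
    rewrite -[D^-1]mul1r ler_pdivlMr// /D; lra.
  case: k ih kn kT kD tk small => [|k] ih kn kT kD tk small.
    by rewrite !mul0r addr0; exact: (energy0_le db).
  have kT' : k.+1%:R * tau <= T.
    by apply: le_trans kT; rewrite ler_wpM2r// ler_nat.
  have bk j : (j < k.+1)%N ->
      energy al be x y p j <= K0 + j%:R * tau * (C * (3 + 2 * K)).
    move=> jk; apply: ih => //; first exact: ltn_trans kn.
    by rewrite le_min (le_trans _ kT) ?(le_trans _ kD)// ler_wpM2r// ler_nat
      ltnS ltnW.
  have EK j : (j < k.+1)%N -> energy al be x y p j <= K.
    move=> jk; apply: le_trans (bk j jk) _; have := small j (leqW (ltnW jk)).
    rewrite /K; lra.
  have pP := position_le db T0' a00 tauT kT' K1 (ltnW kn) EK.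
  have st := energy_step db T0' a00 A0 B0 F0 tauT K1 (kn : (1 <= k.+1 < n)%N)
    EK pP.
  rewrite /= -/C0 in st.
  set e1 := energy al be x y p k.+1 in st *;
    set e0 := energy al be x y p k in st.
  have xe : x k.+2 ^+ 2 <= e1.
    apply: le_trans (energy_ge db (ltnW kn)).
    by rewrite ler_wpDr ?mulr_ge0 ?addr_ge0 ?sqr_ge0 ?invr_ge0// ltW.
  have s1 := small 1%N isT; rewrite mul1r in s1.
  have x20 := sqr_ge0 (x k.+2).
  have tC : tau * (C0 * (1 + x k.+2 ^+ 2)) <= tau * (C * (1 + x k.+2 ^+ 2)).
    apply: ler_wpM2l => //; apply: ler_wpM2r; first by rewrite addr_ge0.
    by rewrite /C lerDl.
  have tC2 : tau * C <= 2^-1.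
    apply: le_trans s1; apply: ler_wpM2l => //.
    rewrite ler_peMr ?(ltW Cpos)//; lra.
  have x2K : 1 + x k.+2 ^+ 2 <= 3 + 2 * K.
    have e0K : e0 <= K by exact: EK.
    have : tau * C * (1 + x k.+2 ^+ 2) <= 2^-1 * (1 + x k.+2 ^+ 2).
      by apply: ler_wpM2r => //; rewrite addr_ge0.
    lra.
  have : tau * C * (1 + x k.+2 ^+ 2) <= tau * C * (3 + 2 * K).
    by apply: ler_wpM2l => //; rewrite mulr_ge0 // ltW.
  have := bk k (ltnSn k); rewrite -/e0 -[k.+1%:R]natr1; lra.
case=> // k /andP[_ kn] kT.
have EK : energy al be x y p k <= K.
  have := claim k kn kT; move: kT; rewrite le_min => /andP[_ kD].
  have : k%:R * tau <= D^-1.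
    by apply: le_trans kD; rewrite ler_wpM2r// ler_nat.
  rewrite -[D^-1]mul1r ler_pdivlMr// /D /K; lra.
have xK := energy_le_x db a00 K1 (ltnW kn) EK.
have Ka : 0 <= 2 * K / a0 by rewrite divr_ge0 ?mulr_ge0// ltW.
split; first by rewrite /M; lra.
have ys : y k.+1 ^+ 2 <= 2 * K / a0.
  rewrite ler_pdivlMr//; have := energy_ge db (ltnW kn).
  have := sqr_ge0 (x k.+1).
  have := mulr_ge0 (ltW a00) (sqr_ge0 (y k)); lra.
have y0 := db_y db k.+1.
suff : y k.+1 <= 1 + 2 * K / a0 by rewrite /M; lra.
by have := sqr_ge0 (y k.+1 - 1); rewrite expr2 in ys *; lra.
Qed.

End discrete_energy.

(** * Completeness of L^2 *)

Section riesz_fischer.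
Context d (T : measurableType d) (R : realType).
Variable mu : {measure set T -> \bar R}.
Let nsq (f : T -> R) : \bar R := (\int[mu]_x ((f x) ^+ 2)%:E)%E.

Lemma Lfun2P (f : T -> R) : measurable_fun setT f -> (nsq f < +oo)%E ->
  f \in Lfun mu 2%:E.
Proof.
move=> mf fin; rewrite inE; apply/andP; split; rewrite inE//=.
rewrite /finite_norm unlock /= poweR_lty//.
apply: le_lt_trans fin; rewrite le_eqVlt; apply/orP; left; apply/eqP.
by apply: eq_integral => x _; rewrite powR_mulrn// real_normK ?num_real.
Qed.

(** The squared increments remain summable in the mean after multiplication by
    [4 ^ k]. The weighted sum is therefore finite almost everywhere, and where
    it is finite the increments are bounded by a geometric sequence. *)
Lemma ae_cvg_of_fast_cauchy (v : nat -> T -> R) :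
  (forall k, measurable_fun setT (v k)) ->
  (forall k, nsq (fun x => v k.+1 x - v k x)%R <= ((8^-1) ^+ k)%:E)%E ->
  {ae mu, forall x, cvgn (v ^~ x)}.
Proof.
move=> mv hv.
pose h k x := (4 ^+ k * (v k.+1 x - v k x) ^+ 2)%:E.
have h0 k x : (0 <= h k x)%E.
  by rewrite lee_fin mulr_ge0 ?sqr_ge0 ?exprn_ge0.
have msq k : measurable_fun setT (EFin \o (fun x => (v k.+1 x - v k x) ^+ 2)).
  by apply/measurable_EFinP; apply: measurable_funX; exact: measurable_funB.
have mh k : measurable_fun setT (h k).
  apply/measurable_EFinP; apply: measurable_funM => //.
  by apply: measurable_funX; exact: measurable_funB.
pose S x := (\sum_(k <oo) h k x)%E.
have mS : measurable_fun setT S by exact: ge0_emeasurable_sum.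
have intS : (\int[mu]_x S x < +oo)%E.
  rewrite integral_nneseries//.
  apply: (@le_lt_trans _ _ (\sum_(k <oo) ((2^-1) ^+ k)%:E)%E).
    apply: lee_nneseries => [k _ _|k _]; first by apply: integral_ge0 => x _;
      exact: h0.
    under eq_integral do rewrite /h EFinM.
    rewrite ge0_integralZl//; last 2 first.
    - exact: msq.
    - by move=> x _; rewrite lee_fin sqr_ge0.
    apply: le_trans (_ : (4 ^+ k)%:E * ((8^-1) ^+ k)%:E <= _)%E.
      by apply: lee_wpmul2l; [rewrite lee_fin exprn_ge0|exact: hv].
    rewrite -EFinM -exprMn lee_fin le_eqVlt; apply/orP; left; apply/eqP.
    by congr (_ ^+ _); lra.
  have : (series (geometric 1 (2^-1 : R))) @ \oo --> (1 * (1 - 2^-1)^-1 : R).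
    by apply: cvg_geometric_series; rewrite ger0_norm//; lra.
  move=> cs.
  have sE : (fun n => \sum_(0 <= k < n) ((2^-1 : R) ^+ k)%:E)%E @ \oo
      --> (1 * (1 - 2^-1)^-1 : R)%:E.
    rewrite (_ : (fun n => _) = EFin \o series (geometric 1 (2^-1 : R))).
      by apply: cvg_EFin cs; exact: nearW.
    apply/funext => n /=; rewrite /series /= sumEFin.
    by congr EFin; apply: eq_bigr => i _; rewrite mul1r.
  by apply: le_lt_trans (ltry (1 * (1 - 2^-1)^-1 : R)); rewrite -(cvg_lim _ sE).
have : mu.-integrable setT S.
  apply/integrableP; split => //.
  under eq_integral do rewrite gee0_abs ?nneseries_ge0//.
  exact: intS.
move=> /integrable_ae -/(_ measurableT); apply: filterS => x /(_ I) finS.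
have hS k : 4 ^+ k * (v k.+1 x - v k x) ^+ 2 <= fine (S x).
  rewrite -lee_fin fineK//.
  apply: le_trans (nneseries_lim_ge k.+1 _) => [|i _ _]; last exact: h0.
  rewrite big_nat_recr//= leeDr//; apply: sume_ge0 => i _; exact: h0.
have S0 : 0 <= fine (S x) by apply: fine_ge0; apply: nneseries_ge0.
pose c := Num.sqrt (fine (S x)).
have dk k : `|v k.+1 x - v k x| <= c * (2^-1) ^+ k.
  have e4 : 4 ^+ k * ((2^-1) ^+ k) ^+ 2 = 1 :> R.
    by rewrite -exprM mulnC exprM -exprMn (_ : 4 * _ = 1) ?expr1n// expr2; lra.
  rewrite -(@ler_pXn2r _ 2) ?nnegrE ?mulr_ge0 ?sqrtr_ge0 ?exprn_ge0//.
  rewrite real_normK ?num_real// exprMn sqr_sqrtr//.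
  by rewrite -(@ler_pM2l _ (4 ^+ k)) ?exprn_gt0// [leRHS]mulrCA e4 mulr1.
have : cvgn (series (fun k => v k.+1 x - v k x)).
  apply: normed_cvg; apply: (@series_le_cvg _ _ (geometric c 2^-1)) => //.
  - by move=> k /=; exact: normr_ge0.
  - by move=> k; rewrite /geometric/= mulr_ge0 ?sqrtr_ge0 ?exprn_ge0.
  - by apply: is_cvg_geometric_series; rewrite ger0_norm//; lra.
move=> cs; have -> : v ^~ x = (fun n => v 0%N x + series (fun k => v k.+1 x - v
  k x) n).
  apply/funext => n; rewrite /series/= (telescope_sumr (v ^~ x))//.
  by rewrite addrC subrK.
by apply: is_cvgD => //; exact: is_cvg_cst.
Qed.

(** A rapidly Cauchy subsequence converges almost everywhere, and Fatou's lemma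
    turns the Cauchy estimates into estimates of the distance to its limit. *)
Lemma L2_complete (u : nat -> T -> R) : (forall n, u n \in Lfun mu 2%:E) ->
  (forall e : R, 0 < e -> exists N, forall m n, (N <= m)%N -> (N <= n)%N ->
     (nsq (fun x => u m x - u n x)%R <= e%:E)%E) ->
  exists2 g : T -> R, g \in Lfun mu 2%:E & forall e : R, 0 < e -> exists N,
    forall n, (N <= n)%N ->
     (nsq (fun x => u n x - g x)%R <= e%:E)%E.
Proof.
move=> uL hu.
have mu_ n : measurable_fun setT (u n).
  by move: (uL n); rewrite inE => /andP[]; rewrite inE.
have /choice[N hN] k : exists N, forall m n, (N <= m)%N -> (N <= n)%N ->
     (nsq (fun x => u m x - u n x)%R <= ((8^-1) ^+ k)%:E)%E.
  by apply: hu; rewrite exprn_gt0.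
(* The summand [k] makes [phi] unbounded. *)
pose phi k := (\max_(i < k.+1) N i + k)%N.
have phiN k : (N k <= phi k)%N by apply: leq_trans (leq_addr _ _);
  apply: (leq_bigmax (ord_max : 'I_k.+1)).
have phiS k : (phi k <= phi k.+1)%N 
  by apply: leq_add (leqnSn k); rewrite [leqRHS]big_ord_recr leq_maxl.
pose v k := u (phi k).
have := @ae_cvg_of_fast_cauchy v; case.
  by move=> k; exact: mu_.
  by move=> k; apply: hN => //; exact: leq_trans (phiS k).
move=> B [mB muB Bv].
pose g x := fine (limn_esup (fun k => (v k x)%:E)).
have mg : measurable_fun setT g.
  apply: measurableT_comp => //; apply: measurable_fun_limn_esup => k.
  by apply/measurable_EFinP; exact: mu_.
have cg : {ae mu, forall x, v ^~ x @ \oo --> g x}.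
  exists B; split=> // x /= ncv; apply: Bv => /= cv; apply: ncv.
  have cE : EFin \o v ^~ x @ \oo --> (limn (v ^~ x))%:E by apply: cvg_EFin cv;
    exact: nearW.
  rewrite /g is_cvg_limn_esupE; last by apply/cvg_ex; eexists; exact: cE.
  by rewrite (cvg_lim _ cE).
have msub (f h : T -> R) : measurable_fun setT f -> measurable_fun setT h ->
    measurable_fun setT (EFin \o (fun x => (f x - h x) ^+ 2)).
  by move=> mf mh; apply/measurable_EFinP; apply: measurable_funX;
    exact: measurable_funB.
have key n e : (forall m, exists2 m', (m <= m')%N &
    forall k, (m' <= k)%N -> (nsq (fun x => v k x - u n x)%R <= e%:E)%E) ->
    (nsq (fun x => u n x - g x)%R <= e%:E)%E.
  move=> he.
  apply: (@le_trans _ _ (\int[mu]_x limn_einf (fun k => ((v k x - u n x) ^+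
    2)%:E))%E).
    apply: ae_ge0_le_integral => //.
    - by move=> x _; rewrite lee_fin sqr_ge0.
    - by apply: msub => //; exact: mu_.
    - move=> x _; rewrite limn_einf_lim; apply: lime_ge;
      first exact: is_cvg_einfs.
      apply: nearW => k; apply: le_ereal_inf_tmp => _ [m /= _ <-].
      by rewrite lee_fin sqr_ge0.
    - pose h k x := (- ((v k x - u n x) ^+ 2)%:E)%E.
      rewrite (_ : (fun x => _) = (fun x => - limn_esup (h ^~ x))%E);
        last first.
        by apply/funext => x; rewrite limn_esupN oppeK.
      apply: measurableT_comp => //; apply: measurable_fun_limn_esup => k.
      by apply: measurableT_comp => //; apply: msub; exact: mu_.
    move: cg; apply: filterS => x cv _.
    have : (fun k => ((v k x - u n x) ^+ 2)%:E) @ \oo --> ((u n x - g x) ^+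
      2)%:E.
      apply: cvg_EFin; first exact: nearW.
      rewrite -sqrrN opprB; apply: cvgM; apply: cvgB => //; exact: cvg_cst.
    by move=> /cvg_limn_einf_sup[-> _].
  apply: le_trans (fatou mu measurableT _ _) _.
  - by move=> k; apply: msub => //; exact: mu_.
  - by move=> k x _; rewrite lee_fin sqr_ge0.
  rewrite limn_einf_lim; apply: lime_le; first exact: is_cvg_einfs.
  apply: nearW => k; have [m' km' hm'] := he k.
  apply: ge_ereal_inf; exists (nsq (fun x => v m' x - u n x)).
    by exists m'.
  exact: hm'.
have gL : g \in Lfun mu 2%:E.
  have k0 : (nsq (fun x => u (phi 0%N) x - g x)%R <= 1%:E)%E.
    apply: key => m; exists m => // k mk; rewrite -(expr0 (8^-1)).
    apply: hN => //; apply: leq_trans (phiN 0%N) _.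
    by elim: {mk} k => // k ih; exact: leq_trans (phiS k).
  have dL : (fun x => u (phi 0%N) x - g x) \in Lfun mu 2%:E.
    apply: Lfun2P; first exact: measurable_funB.
    exact: le_lt_trans k0 (ltry _).
  have -> : g = u (phi 0%N) \- (fun x => u (phi 0%N) x - g x).
    by apply/funext => x /=; rewrite opprB addrC subrK.
  exact: (LfunP (Lfun_Sub (lee1n 2) (uL (phi 0%N)) - Lfun_Sub (lee1n 2) dL)).
exists g; [exact: gL|move=> e e0].
have [M hM] := hu _ e0; exists M => n Mn; apply: key => m.
exists (maxn m M); first exact: leq_maxl.
by move=> k; rewrite geq_max => /andP[_ Mk]; apply: hM => //;
  exact: leq_trans (leq_addl _ _).
Qed.
End riesz_fischer.

(** * The Hilbert space structure *)

Section inner_product.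
Context (R : realType) (Om : convex_domain R).
Implicit Types u v w : L2 Om.

#[local] Instance ae_mu2_filter : Filter (nbhs (almost_everywhere (mu2 Om))).
Proof. exact: ae_filter_ringOfSetsType. Qed.

Lemma L2_mul_integrable u v :
  (mu2 Om).-integrable setT (EFin \o (fun x => u x * v x)).
Proof.
by apply/Lfun1_integrable; apply: Lfun2_mul_Lfun1; exact: LfunP.
Qed.

Lemma dotC u v : dot u v = dot v u.
Proof. by apply: eq_Rintegral => x _; rewrite mulrC. Qed.

Lemma dotDl u v w : dot (u + v) w = dot u w + dot v w.
Proof.
rewrite /dot -RintegralD//; try exact: L2_mul_integrable.
by apply: eq_Rintegral => x _; rewrite -mulrDl.
Qed.

Lemma dotZl a u w : dot (a *: u) w = a * dot u w.
Proof.
rewrite /dot -RintegralZl//; last exact: L2_mul_integrable.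
by apply: eq_Rintegral => x _; rewrite mulrA.
Qed.

Lemma dotNl u w : dot (- u) w = - dot u w.
Proof. by rewrite -scaleN1r dotZl mulN1r. Qed.

Lemma dotBl u v w : dot (u - v) w = dot u w - dot v w.
Proof. by rewrite dotDl dotNl. Qed.

Lemma dotDr w u v : dot w (u + v) = dot w u + dot w v.
Proof. by rewrite dotC dotDl !(dotC w). Qed.

Lemma dotZr a w u : dot w (a *: u) = a * dot w u.
Proof. by rewrite dotC dotZl dotC. Qed.

Lemma dotNr w u : dot w (- u) = - dot w u.
Proof. by rewrite dotC dotNl dotC. Qed.

Lemma dotBr w u v : dot w (u - v) = dot w u - dot w v.
Proof. by rewrite dotDr dotNr. Qed.

Lemma dotDB u v : dot (u + v) (u - v) = dot u u - dot v v.
Proof. by rewrite dotDl !dotBr (dotC v u) addrA subrK. Qed.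

Lemma dot0l w : dot 0 w = 0.
Proof. by rewrite -(scale0r w) dotZl mul0r. Qed.

Definition dotE := (dotDl, dotDr, dotBl, dotBr, dotNl, dotNr, dotZl, dotZr).

Lemma eqL2_refl u : eqL2 u u. Proof. exact: ae_eq_refl. Qed.

Lemma eqL2_sym u v : eqL2 u v -> eqL2 v u. Proof. exact: ae_eq_sym. Qed.

Lemma eqL2_trans u v w : eqL2 u v -> eqL2 v w -> eqL2 u w.
Proof. exact: ae_eq_trans. Qed.

Lemma dot_ae u u' v : eqL2 u u' -> dot u v = dot u' v.
Proof.
move=> uu'; congr fine; apply: ae_eq_integral => //.
- by have /measurable_int := L2_mul_integrable u v.
- by have /measurable_int := L2_mul_integrable u' v.
- by move: uu'; apply: filterS => x /(_ I) e _; rewrite e.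
Qed.

Lemma dot_aer u v v' : eqL2 v v' -> dot u v = dot u v'.
Proof. by move=> e; rewrite dotC (dot_ae _ e) dotC. Qed.

Lemma dot_ge0 u : 0 <= dot u u.
Proof. by apply: Rintegral_ge0 => x _; rewrite -expr2 sqr_ge0. Qed.

Lemma EFin_dot u : (dot u u)%:E = (\int[mu2 Om]_x ((u x : R) ^+ 2)%:E)%E.
Proof.
rewrite /dot /Rintegral fineK; last first.
  by apply: integrable_fin_num => //; exact: L2_mul_integrable.
by apply: eq_integral => x _; rewrite expr2.
Qed.

Lemma norm2_ge0 u : 0 <= norm2 u.
Proof. by apply: fine_ge0; exact: Lnorm_ge0. Qed.

Lemma norm2_sqr u : norm2 u ^+ 2 = dot u u.
Proof.
apply: EFin_inj; rewrite EFin_dot -powR_mulrn ?norm2_ge0//.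
rewrite -poweR_EFin finite_norm_fine powR_Lnorm ?pnatr_eq0//.
by apply: eq_integral => x _;
  rewrite poweR_EFin powR_mulrn// real_normK ?num_real.
Qed.

Lemma norm2E u : norm2 u = Num.sqrt (dot u u).
Proof. by rewrite -norm2_sqr sqrtr_sqr ger0_norm ?norm2_ge0. Qed.

Lemma dot_eq0 u : dot u u = 0 -> eqL2 u 0.
Proof.
by move=> u0; apply: fine_Lnormr_eq0; have := norm2E u; rewrite u0 sqrtr0.
Qed.

Lemma eqL2_dotB u v : dot (u - v) (u - v) = 0 -> eqL2 u v.
Proof.
move=> /dot_eq0; apply: filterS => x /(_ I) e _.
by apply/eqP; rewrite -subr_eq0; apply/eqP.
Qed.

End inner_product.

Section abstract_cauchy_schwarz.
Variable R : realFieldType.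

Lemma quadratic_CS (a b c : R) : 0 <= c ->
  (forall t, 0 <= a - t * b *+ 2 + t ^+ 2 * c) -> b ^+ 2 <= a * c.
Proof.
rewrite le_eqVlt => /predU1P[<- h|c0 h].
  have [->|b0] := eqVneq b 0; first by rewrite mulr0 expr0n.
  have := h ((a + 1) / b); rewrite divfK// => h1.
  have := h 0 => h2; lra.
have h1 := mulr_ge0 (h (b / c)) (ltW c0).
have c0' : c != 0 by rewrite gt_eqF.
rewrite -subr_ge0.
by rewrite (_ : _ - _ = (a - b / c * b *+ 2 + (b / c) ^+ 2 * c) * c)//; field.
Qed.
End abstract_cauchy_schwarz.

Section hilbert.
Context (R : realType) (Om : convex_domain R).
Implicit Types u v w : L2 Om.

Lemma dot_sqr_le u v : dot u v ^+ 2 <= dot u u * dot v v.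
Proof.
apply: quadratic_CS (dot_ge0 v) _ => t.
rewrite (_ : _ + _ = dot (u - t *: v) (u - t *: v)) ?dot_ge0//.
by rewrite !dotE (dotC v u); ring.
Qed.

Lemma dot_norm2_le u v : `|dot u v| <= norm2 u * norm2 v.
Proof.
rewrite -(@ler_pXn2r _ 2) ?nnegrE ?mulr_ge0 ?norm2_ge0//.
by rewrite real_normK ?num_real// exprMn !norm2_sqr dot_sqr_le.
Qed.

Definition cvgL2 (u_ : nat -> L2 Om) (u : L2 Om) : Prop :=
  dot (u_ n - u) (u_ n - u) @[n --> \oo] --> (0 : R).

Lemma cvgL2_dotl (u_ : nat -> L2 Om) u v : cvgL2 u_ u ->
  dot (u_ n) v @[n --> \oo] --> dot u v.
Proof.
move=> cu; apply/subr_cvg0.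
have : Num.sqrt (dot (u_ n - u) (u_ n - u)) * norm2 v @[n --> \oo] --> (0 : R).
  rewrite -(mul0r (norm2 v)); apply: cvgMl; rewrite -(@sqrtr0 R).
  by apply: continuous_cvg cu; exact: sqrt_continuous.
move=> h; apply/norm_cvg0P.
apply: (squeeze_cvgr _ (cvg_cst (0 : R)) h); apply: nearW => n.
rewrite normr_ge0/=.
by have := dot_norm2_le (u_ n - u) v; rewrite dotBl norm2E.
Qed.

Lemma cvgL2_dot (u_ v_ : nat -> L2 Om) u v : cvgL2 u_ u -> cvgL2 v_ v ->
  dot (u_ n) (v_ n) @[n --> \oo] --> dot u v.
Proof.
move=> cu cv.
have h1 := cvgL2_dotl (v := v) cu.
have h2 := cvgL2_dotl (v := u) cv.
have h3 : dot (u_ n - u) (v_ n - v) @[n --> \oo] --> (0 : R).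
  apply/norm_cvg0P.
  have : Num.sqrt (dot (u_ n - u) (u_ n - u)) * Num.sqrt (dot (v_ n - v) (v_ n
    - v))
     @[n --> \oo] --> (0 : R).
    rewrite -[X in _ --> X](mul0r (0 : R)); apply: cvgM; rewrite -(@sqrtr0 R).
      by apply: continuous_cvg cu; exact: sqrt_continuous.
    by apply: continuous_cvg cv; exact: sqrt_continuous.
  move=> h; apply: (squeeze_cvgr _ (cvg_cst (0 : R)) h); apply: nearW => n.
  by rewrite normr_ge0/=; have := dot_norm2_le (u_ n - u) (v_ n - v);
    rewrite !norm2E.
rewrite (_ : (fun n => dot (u_ n) (v_ n)) = (fun n =>
    dot (u_ n - u) (v_ n - v) + dot (u_ n) v + (dot (v_ n) u - dot u v))).
  rewrite [X in _ --> X](_ : _ = 0 + dot u v + (dot v u - dot u v)).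
    by apply: cvgD; [exact: cvgD|apply: cvgB => //; exact: cvg_cst].
  by rewrite add0r (dotC v u) subrr addr0.
by apply/funext => n; rewrite !dotE (dotC (v_ n) u); ring.
Qed.

Lemma cauchy_cvgL2 (u_ : nat -> L2 Om) :
  (forall e : R, 0 < e -> exists N, forall m n, (N <= m)%N -> (N <= n)%N ->
     dot (u_ m - u_ n) (u_ m - u_ n) <= e) ->
  exists u, cvgL2 u_ u.
Proof.
move=> hu.
have uL n : (u_ n : R * R -> R) \in Lfun (mu2 Om) 2%:E by exact: LfunP.
have [|g gL hg] := L2_complete uL.
  move=> e /hu[N hN]; exists N => m n Nm Nn.
  by have := hN m n Nm Nn; rewrite -lee_fin EFin_dot.
exists (Lfun_Sub (lee1n 2) gL); apply/cvgrPdist_le => e /hg[N hN].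
exists N => // n /hN; rewrite sub0r normrN ger0_norm ?dot_ge0// -lee_fin.
by rewrite EFin_dot.
Qed.

End hilbert.

(** * Step functions of the operator *)

Section step_functions.
Context {R : realType}.

(** A step function is kept as a formal sum, with sets that may overlap, so that
    the same data define a function of the spectral variable and an operator;
    nonnegativity and measurability are part of the type. *)
Definition step := seq ({nonneg R} * {A : set R | measurable A}).

Definition step_val (l : step) (x : R) : R :=
  \sum_(p <- l) p.1%:num * \1_(sval p.2) x.

Definition step_mul (l l' : step) : step :=
  [seq ((p.1%:num * q.1%:num)%:nng,
        exist _ (sval p.2 `&` sval q.2) (measurableI _ _ (svalP p.2) (svalP
          q.2)))
  | p <- l, q <- l'].

Lemma step_val_mul l l' x :
  step_val (step_mul l l') x = step_val l x * step_val l' x.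
Proof.
rewrite /step_val /step_mul big_allpairs_dep/= mulr_suml.
apply: eq_bigr => p _; rewrite mulr_sumr; apply: eq_bigr => q _.
by rewrite indicI/=; ring.
Qed.

Lemma step_val_ge0 l x : 0 <= step_val l x.
Proof. by apply: sumr_ge0 => p _; rewrite mulr_ge0// indicE. Qed.

Lemma measurable_step_val l : measurable_fun setT (step_val l).
Proof.
apply: measurable_sum => p; apply: measurable_funM => //.
by apply: measurable_indic; exact: svalP.
Qed.

Definition approximates (l_ : nat -> step) (phi : R -> R) : Prop :=
  (forall x, nondecreasing_seq (fun n => step_val (l_ n) x)) /\
  (forall x, step_val (l_ n) x @[n --> \oo] --> phi x).

Lemma approximates_sqr l_ phi : approximates l_ phi ->
  approximates (fun n => step_mul (l_ n) (l_ n)) (fun x => phi x ^+ 2).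
Proof.
move=> [nd h]; split=> x.
  move=> m n mn; rewrite !step_val_mul ler_pM ?step_val_ge0//; exact: nd.
under eq_fun do rewrite step_val_mul -expr2.
by apply: cvgM; exact: h.
Qed.

Import HBNNSimple.

Lemma nnsfun_step (s : {nnsfun R >-> R}) : exists l : step, step_val l =1 s.
Proof.
have ms c : measurable (s @^-1` [set c]) by exact: measurable_sfunP.
exists [seq ((`|c|)%:nng, exist _ _ (ms c)) | c <- finmap.enum_fset (fset_set
  (range s))] => x.
rewrite fimfunE fsbig_finite//= /step_val big_map.
rewrite big_seq [RHS]big_seq; apply: eq_bigr => c.
by rewrite in_fset_set// inE => -[y _ <-] /=; rewrite ger0_norm.
Qed.

Lemma approximates_exists (phi : R -> R) : measurable_fun setT phi ->
  (forall x, 0 <= phi x) -> exists l_, approximates l_ phi.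
Proof.
move=> mphi phi0.
have mE : measurable_fun setT (EFin \o phi) by exact/measurable_EFinP.
pose s := nnsfun_approx measurableT mE.
have /choice[l_ hl] n := nnsfun_step (s n).
exists l_; split=> x.
  move=> m n mn; rewrite !hl.
  by have /lefP := nd_nnsfun_approx measurableT mE mn; exact.
under eq_fun do rewrite hl.
have h : EFin \o (fun n => s n x) @ \oo --> (phi x)%:E.
  by apply: (@cvg_nnsfun_approx _ _ _ _ measurableT _ mE) => // y _;
    rewrite lee_fin.
by move/fine_cvg : h.
Qed.

End step_functions.

Section spectral_calculus.
Context (R : realType) (Om : convex_domain R) (E : spectral_measure Om).
Implicit Types u v w g : L2 Om.
Local Notation P := (sp_proj E).
Local Notation M := (sp_mu E).

Lemma proj_dot (A : set R) u v : measurable A -> dot (P A u) v = dot u (P A v).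
Proof. by move=> mA; exact: sp_sym. Qed.

Lemma proj_mulr (A B : set R) u v : measurable A -> measurable B ->
  dot (P A u) (P B v) = dot (P (A `&` B) u) v.
Proof.
move=> mA mB; rewrite -proj_dot//; apply: dot_ae; apply: eqL2_sym.
by rewrite setIC; exact: sp_mul.
Qed.

Lemma proj_ae (A : set R) u u' v : measurable A -> eqL2 u u' ->
  dot (P A u) v = dot (P A u') v.
Proof. by move=> mA uu'; rewrite !proj_dot// (dot_ae _ uu'). Qed.

Lemma spmu_eqL2 (A : set R) u u' : measurable A -> eqL2 u u' -> M u A = M u' A.
Proof.
by move=> mA uu'; rewrite !sp_muE// (proj_ae _ mA uu') (dot_aer _ uu').
Qed.

Lemma spmu_proj (A B : set R) u : measurable A -> measurable B ->
  M (P B u) A = M u (A `&` B).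
Proof.
move=> mA mB; rewrite !sp_muE//; last exact: measurableI.
have mAB := measurableI _ _ mA mB.
by rewrite proj_mulr// proj_dot// proj_mulr// setICA setIid.
Qed.

Lemma spmu_parallelogram (A : set R) u v : measurable A ->
  (M (u + v)%R A + M (u - v)%R A = (M u A + M u A) + (M v A + M v A))%E.
Proof.
move=> mA; rewrite !sp_muE// -!EFinD; congr EFin.
by rewrite !dotE !proj_dot// !dotE -!proj_dot//; ring.
Qed.

Lemma spmu_scale (A : set R) c u : measurable A ->
  (M (c *: u)%R A = (c ^+ 2)%:E * M u A)%E.
Proof.
move=> mA; rewrite !sp_muE// -EFinM; congr EFin.
by rewrite dotZr proj_dot// dotZl -proj_dot//; ring.
Qed.

Lemma integral_spmu_eqL2 u u' (f : R -> \bar R) : eqL2 u u' ->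
  (\int[M u]_x f x = \int[M u']_x f x)%E.
Proof.
by move=> uu'; apply: eq_measure_integral => A mA _; exact: spmu_eqL2.
Qed.

Lemma integral_spmu_parallelogram u v (f : R -> \bar R) :
  measurable_fun setT f -> (forall x, 0 <= f x)%E ->
  (\int[M (u + v)%R]_x f x + \int[M (u - v)%R]_x f x =
   (\int[M u]_x f x + \int[M u]_x f x) + (\int[M v]_x f x + \int[M v]_x f x))%E.
Proof.
move=> mf f0; rewrite -!ge0_integral_measure_add//.
apply: eq_measure_integral => A mA _.
rewrite [LHS]measure_addE [RHS]measure_addE spmu_parallelogram//.
by congr (_ + _)%E; exact: esym (measure_addE _ _ _).
Qed.

Lemma integral_spmu_scale c u (f : R -> \bar R) :
  measurable_fun setT f -> (forall x, 0 <= f x)%E ->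
  (\int[M (c *: u)%R]_x f x = (c ^+ 2)%:E * \int[M u]_x f x)%E.
Proof.
move=> mf f0.
rewrite -(@ge0_integral_mscale _ _ _ (M u) _ measurableT (NngNum (sqr_ge0
  c)))//.
by apply: eq_measure_integral => A mA _; rewrite spmu_scale.
Qed.

Definition step_op (l : step) u : L2 Om :=
  \sum_(p <- l) p.1%:num *: P (sval p.2) u.

Lemma dot_step_op l u v :
  dot (step_op l u) v = \sum_(p <- l) p.1%:num * dot (P (sval p.2) u) v.
Proof.
rewrite /step_op (big_morph (fun w => dot w v)
  (fun a b => dotDl a b v) (dot0l v)).
by apply: eq_bigr => p _; rewrite dotZl.
Qed.

Lemma step_op_sym l u v : dot (step_op l u) v = dot u (step_op l v).
Proof.
rewrite [RHS]dotC !dot_step_op; apply: eq_bigr => p _.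
by rewrite proj_dot; [rewrite dotC|exact: svalP].
Qed.

Lemma step_op_mul l l' u v :
  dot (step_op (step_mul l l') u) v = dot (step_op l u) (step_op l' v).
Proof.
rewrite !dot_step_op /step_mul big_allpairs_dep/=; apply: eq_bigr => p _.
rewrite [dot _ (step_op _ _)]dotC dot_step_op mulr_sumr.
apply: eq_bigr => q _.
rewrite [dot (P (sval q.2) v) _]dotC proj_mulr;
  [by rewrite mulrA|exact: svalP|exact: svalP].
Qed.

Lemma integral_step_val l u :
  (\int[M u]_x (step_val l x)%:E = (dot (step_op l u) u)%:E)%E.
Proof.
rewrite dot_step_op.
under eq_integral do rewrite /step_val -sumEFin.
rewrite ge0_integral_sum//=; last first.
  move=> p; apply/measurable_EFinP; apply: measurable_funM => //.
  by apply: measurable_indic; exact: svalP.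
rewrite -sumEFin; apply: eq_bigr => p _.
under eq_integral do rewrite EFinM.
rewrite ge0_integralZl//=; last first.
  by apply/measurable_EFinP; apply: measurable_indic; exact: svalP.
by rewrite integral_indic//= ?setIT ?sp_muE//; exact: svalP.
Qed.

Lemma step_op_polar l u v : dot (step_op l u) v = 4^-1 *
  (dot (step_op l (u + v)) (u + v) - dot (step_op l (u - v)) (u - v)).
Proof.
have sym w := step_op_sym l w.
rewrite (sym (u + v)) (sym (u - v)) !dotE -!sym !dotE.
by rewrite (sym v u) (dotC v); field.
Qed.

(** The form of a step operator at [u] is the integral of the step function
    against [d(P u, u)], so this is the monotone convergence theorem. *)
Lemma cvg_step_op_form l_ phi u : approximates l_ phi ->
  (dot (step_op (l_ n) u) u)%:E @[n --> \oo] --> (\int[M u]_x (phi x)%:E)%E.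
Proof.
move=> [nd cv].
rewrite (_ : (fun n => _) = (fun n => \int[M u]_x (step_val (l_ n) x)%:E)%E).
  rewrite (_ : (\int[M u]_x (phi x)%:E)%E =
      (\int[M u]_x limn (fun n => (step_val (l_ n) x)%:E))%E).
    apply: cvg_monotone_convergence => //.
    - by move=> n; apply/measurable_EFinP; exact: measurable_step_val.
    - by move=> n x _; rewrite lee_fin step_val_ge0.
    - by move=> x _ m n mn; rewrite lee_fin; exact: nd.
  apply: eq_integral => x _; apply/esym/cvg_lim => //.
  by apply: cvg_EFin (cv x); exact: nearW.
by apply/funext => n; rewrite integral_step_val.
Qed.

Lemma step_op_cvgL2_form l_ phi u g : approximates l_ phi ->
  cvgL2 (fun n => step_op (l_ n) u) g ->
  (\int[M u]_x (phi x)%:E = (dot g u)%:E)%E.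
Proof.
move=> ap cg; rewrite -(cvg_lim _ (cvg_step_op_form (u := u) ap))//.
apply/cvg_lim => //; by apply: cvg_EFin; [exact: nearW|exact: cvgL2_dotl cg].
Qed.

Lemma step_op_cvgL2_norm l_ phi u g : approximates l_ phi ->
  cvgL2 (fun n => step_op (l_ n) u) g ->
  (\int[M u]_x (phi x ^+ 2)%:E = (dot g g)%:E)%E.
Proof.
move=> ap cg.
rewrite -(cvg_lim _ (cvg_step_op_form (u := u) (approximates_sqr ap)))//.
apply/cvg_lim => //.
apply: cvg_EFin; first exact: nearW.
under eq_fun do rewrite /= step_op_mul.
by apply: cvgL2_dot.
Qed.

(** For [m >= n] the cross term [(s_m u, s_n u)] dominates [(s_n u, s_n u)], so
    the squared distance of two terms is at most the increment of the bounded
    nondecreasing sequence of their squared norms. *)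
Lemma step_op_is_cvgL2 l_ phi u : approximates l_ phi ->
  (\int[M u]_x (phi x ^+ 2)%:E < +oo)%E ->
  exists g, cvgL2 (fun n => step_op (l_ n) u) g.
Proof.
move=> ap fin.
have ap2 := approximates_sqr ap.
pose a n := dot (step_op (l_ n) u) (step_op (l_ n) u).
have cross m n : (n <= m)%N ->
    a n <= dot (step_op (l_ m) u) (step_op (l_ n) u).
  move=> nm; rewrite -lee_fin /a -!step_op_mul -!integral_step_val.
  apply: ge0_le_integral => //.
  - by move=> x _; rewrite lee_fin step_val_ge0.
  - by apply/measurable_EFinP; exact: measurable_step_val.
  - by apply/measurable_EFinP; exact: measurable_step_val.
  - move=> x _; rewrite lee_fin !step_val_mul ler_wpM2r ?step_val_ge0//.
    by case: ap => nd _; exact: nd.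
have dist m n : (n <= m)%N -> dot (step_op (l_ m) u - step_op (l_ n) u)
    (step_op (l_ m) u - step_op (l_ n) u) <= a m - a n.
  move=> /cross; rewrite !dotE (dotC (step_op (l_ n) u)) -/(a m) -/(a n); lra.
have ca : cvgn a.
  have := cvg_step_op_form (u := u) ap2.
  rewrite (_ : (fun n => _) = EFin \o a); last first.
    by apply/funext => n; rewrite /= step_op_mul.
  rewrite -(@fineK _ (\int[M u]_x (phi x ^+ 2)%:E)%E); last first.
    rewrite ge0_fin_numE//; apply: integral_ge0 => x _.
    by rewrite lee_fin sqr_ge0.
  by move=> /fine_cvg h; apply/cvg_ex; eexists; exact: h.
move/cvg_ex: ca => [b cb].
apply: cauchy_cvgL2 => e e0.
have /cvgrPdist_le/(_ (e / 2)) := cb; rewrite divr_gt0// => /(_ isT)[N _ hN].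
exists N => m n; wlog nm : m n / (n <= m)%N => [hw Nm Nn|Nm Nn].
  have [nm|/ltnW mn] := leqP n m; first exact: hw.
  by have := hw n m mn Nn Nm; rewrite -[in X in X -> _]opprB dotNl dotNr opprK.
apply: le_trans (dist _ _ nm) _.
have := hN m Nm; have := hN n Nn;
  rewrite /= !ler_norml => /andP[? ?] /andP[? ?].
lra.
Qed.

End spectral_calculus.

(** * Powers defined by the spectral measure *)

Section spectral_powers.
Context (R : realType) (Om : convex_domain R) (E : spectral_measure Om).
Implicit Types u v w g : L2 Om.
Local Notation P := (sp_proj E).
Local Notation M := (sp_mu E).

(** The cutoff turns integrals over the half-line that carries the spectral
    measure into integrals over the whole line. *)
Definition pow_cut (a x : R) : R := x `^ a * \1_(`[0, +oo[%classic) x.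

Lemma pow_cut_ge0 a x : 0 <= pow_cut a x.
Proof. by rewrite mulr_ge0 ?powR_ge0// indicE. Qed.

Lemma measurable_pow_cut a : measurable_fun setT (pow_cut a).
Proof.
apply: measurable_funM; first exact: measurable_powR.
exact: measurable_indic.
Qed.

Lemma pow_cut_sqr a x : pow_cut a x ^+ 2 = pow_cut (2 * a) x.
Proof.
rewrite /pow_cut exprMn mulrC (mulrC 2) powRrM powR_mulrn ?powR_ge0//.
by rewrite indicE; case: (_ \in _);
  rewrite ?expr1n ?mulr1 ?mul1r// expr0n/= mul0r mulr0.
Qed.

Lemma integral_pow_cut u a :
  (\int[M u]_(x in `[0%R, +oo[) (x `^ a)%:E = \int[M u]_x (pow_cut a x)%:E)%E.
Proof.
rewrite integral_mkcond; apply: eq_integral => x _.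
rewrite /patch /pow_cut indicE; case: ifPn => _; first by rewrite mulr1.
by rewrite mulr0.
Qed.

Lemma sp_domE a u :
  sp_dom E a u <-> (\int[M u]_x (pow_cut a x ^+ 2)%:E < +oo)%E.
Proof.
rewrite /sp_dom integral_pow_cut.
under [X in _ <-> (X < _)%E]eq_integral do rewrite pow_cut_sqr.
exact: iff_refl.
Qed.

Let mpow2 a : measurable_fun setT (fun x => (pow_cut a x ^+ 2)%:E : \bar R).
Proof.
by apply/measurable_EFinP; apply: measurable_funX; exact: measurable_pow_cut.
Qed.

Let pow20 a x : (0 <= (pow_cut a x ^+ 2)%:E)%E.
Proof. by rewrite lee_fin sqr_ge0. Qed.

Lemma sp_domDB a u v : sp_dom E a u -> sp_dom E a v ->
  sp_dom E a (u + v) /\ sp_dom E a (u - v).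
Proof.
move=> /sp_domE du /sp_domE dv.
have := integral_spmu_parallelogram E u v (mpow2 a) (pow20 a).
set I1 := (\int[M (u + v)%R]_x _)%E; set I2 := (\int[M (u - v)%R]_x _)%E => e.
have fin : (I1 + I2 < +oo)%E.
  by rewrite e; apply: lte_add_pinfty; apply: lte_add_pinfty.
have I10 : (0 <= I1)%E by exact: integral_ge0.
have I20 : (0 <= I2)%E by exact: integral_ge0.
split; apply/sp_domE; apply: le_lt_trans fin; first by rewrite leeDl.
by rewrite leeDr.
Qed.

Lemma sp_dom_eqL2 a u u' : eqL2 u u' -> sp_dom E a u -> sp_dom E a u'.
Proof.
by move=> uu' /sp_domE du; apply/sp_domE; rewrite -(integral_spmu_eqL2 _ _ uu').
Qed.

Lemma sp_domZ a c u : sp_dom E a u -> sp_dom E a (c *: u).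
Proof.
move=> /sp_domE du; apply/sp_domE; rewrite integral_spmu_scale//.
by rewrite lte_mul_pinfty// ?lee_fin ?sqr_ge0.
Qed.

(** Spectral truncations lie in the domain of every nonnegative power; they are
    the test vectors for uniqueness and for [half_bounded_sp_dom]. *)
Lemma sp_dom_proj_bounded a (N : nat) w : 0 <= a ->
  sp_dom E a (P `[0, N%:R]%classic w).
Proof.
move=> a0; apply/sp_domE; set B := `[0, N%:R]%classic; set v := P B w.
have mB : measurable B by exact: measurable_itv.
have vB : M v (~` B) = 0%E.
  by rewrite spmu_proj//; [rewrite setICl measure0|exact: measurableC].
apply: (@le_lt_trans _ _ (\int[M v]_x (N%:R `^ (2 * a))%:E)%E); last first.
  rewrite integral_cst//= sp_muE// -EFinM ltry.
  by [].
apply: ae_ge0_le_integral => //.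
exists (~` B); split => //; first exact: measurableC.
move=> x /= nx Bx; apply: nx => _; rewrite lee_fin pow_cut_sqr /pow_cut.
move: Bx; rewrite /B/= in_itv/= => /andP[x0 xN].
rewrite indicE mem_set ?mulr1/= ?in_itv/= ?x0//.
by apply: ge0_ler_powR; rewrite ?nnegrE ?mulr_ge0.
Qed.

Lemma itv0y_bigcup : `[0, +oo[%classic = \bigcup_n (`[0, n%:R]%classic : set R).
Proof.
apply/seteqP; split=> [x|x [n _]]/=; rewrite !in_itv/= ?andbT.
  move=> x0; exists (Num.truncn x).+1 => //=.
  by rewrite in_itv/= x0 ltW// truncnS_gt.
by case/andP.
Qed.

Lemma spmu_eq0 w : (forall N : nat, M w `[0, N%:R]%classic = 0%E) ->
  eqL2 w 0.
Proof.
move=> h; apply: dot_eq0; apply: EFin_inj.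
have <- : M w `[0, +oo[%classic = (dot w w)%:E.
  by rewrite sp_muE//; congr EFin; apply: dot_ae; exact: sp_full.
rewrite itv0y_bigcup; apply/eqP; rewrite -measure_le0.
apply: (@le_trans _ _ (\sum_(n <oo) M w `[0%R, n%:R]%classic)%E).
  apply: measure_sigma_subadditive => //.
  by apply: bigcup_measurable => n _; exact: measurable_itv.
by rewrite eseries0.
Qed.

(** Two values agree against the truncations of their own difference, which
    exhaust its spectral mass. *)
Lemma sp_pow_unique a u g g' : 0 <= a ->
  sp_pow E a u g -> sp_pow E a u g' -> eqL2 g g'.
Proof.
move=> a0 [_ h] [_ h'].
suff /eqL2_dotB : dot (g - g') (g - g') = 0 by [].
have /dot_ae -> : eqL2 (g - g') 0; last by rewrite dot0l.
apply: spmu_eq0 => N; rewrite sp_muE//; congr EFin.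
have dv := @sp_dom_proj_bounded a N (g - g') a0.
by rewrite dotC dotBl (h _ dv) (h' _ dv) subrr.
Qed.

Section fixed_power.
Variables (a : R) (l_ : nat -> @step R).
Hypothesis ap : approximates l_ (pow_cut a).

Lemma sp_pow_form u g : cvgL2 (fun n => step_op E (l_ n) u) g ->
  \int[M u]_(x in `[0, +oo[) (x `^ a) = dot g u.
Proof.
by move=> cg; rewrite /Rintegral integral_pow_cut (step_op_cvgL2_form ap cg).
Qed.

(** Both sides of the weak definition are limits of the polarization identity
    for step operators. *)
Lemma sp_pow_of_cvgL2 u g : cvgL2 (fun n => step_op E (l_ n) u) g ->
  sp_pow E a u g.
Proof.
move=> cg; have du : sp_dom E a u.
  by apply/sp_domE; rewrite (step_op_cvgL2_norm ap cg) ltry.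
split=> // v dv; have [dD dB] := sp_domDB du dv.
have [gD cD] := step_op_is_cvgL2 ap ((sp_domE _ _).1 dD).
have [gB cB] := step_op_is_cvgL2 ap ((sp_domE _ _).1 dB).
rewrite (sp_pow_form cD) (sp_pow_form cB).
have h1 := cvgL2_dotl (v := v) cg.
rewrite -(cvg_lim _ h1)//; apply/cvg_lim => //.
under eq_fun do rewrite step_op_polar.
by apply: cvgM; [exact: cvg_cst|apply: cvgB; exact: cvgL2_dotl].
Qed.

(** The limit of the step operators is a value of the power, so by uniqueness it
    is the given one; identities between powers are then limits of identities
    between finite sums. *)
Lemma sp_pow_cvgL2 u g : 0 <= a -> sp_pow E a u g ->
  cvgL2 (fun n => step_op E (l_ n) u) g.
Proof.
move=> a0 ug; have [g' cg'] := step_op_is_cvgL2 ap ((sp_domE _ _).1 ug.1).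
have e := sp_pow_unique a0 ug (sp_pow_of_cvgL2 cg').
suff : forall n, dot (step_op E (l_ n) u - g) (step_op E (l_ n) u - g) =
                 dot (step_op E (l_ n) u - g') (step_op E (l_ n) u - g').
  by move=> h; rewrite /cvgL2; under eq_fun do rewrite h.
by move=> n; rewrite !dotE !(dot_ae _ e) !(dot_aer _ e).
Qed.

Lemma sp_pow_exists u : sp_dom E a u -> exists g, sp_pow E a u g.
Proof.
move=> du; have [g cg] := step_op_is_cvgL2 ap ((sp_domE _ _).1 du).
by exists g; exact: sp_pow_of_cvgL2.
Qed.

End fixed_power.
End spectral_powers.

(** * The operator and its square root *)

Section half_power.
Context (R : realType) (Om : convex_domain R).
Implicit Types u v w g h k l f : L2 Om.

(** One sequence serves both powers: the squares of step functions increasing to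
    the square root increase to the identity. *)
Lemma half_steps_exist : exists l_ : nat -> @step R,
  approximates l_ (pow_cut 2^-1) /\
  approximates (fun n => step_mul (l_ n) (l_ n)) (pow_cut 1).
Proof.
have [l_ ap] := approximates_exists (@measurable_pow_cut R 2^-1) (pow_cut_ge0
  2^-1).
exists l_; split=> //; have := approximates_sqr ap.
rewrite (_ : (fun x => _) = pow_cut 1)//.
by apply/funext => x; rewrite pow_cut_sqr divff// pnatr_eq0.
Qed.

Lemma eqL2_ext u v : (forall w, dot u w = dot v w) -> eqL2 u v.
Proof. by move=> h; apply: eqL2_dotB; rewrite dotBl h subrr. Qed.

Section given_resolution.
Variable E : spectral_measure Om.

Lemma sp_pow1_dom_half h l : sp_pow E 1 h l -> sp_dom E 2^-1 h.
Proof.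
have [l_ [ap ap1]] := half_steps_exist.
move=> /(sp_pow_cvgL2 ap1 ler01) ch; apply/sp_domE.
under eq_integral do rewrite pow_cut_sqr divff ?pnatr_eq0//.
by rewrite (step_op_cvgL2_form ap1 ch) ltry.
Qed.

Lemma sp_pow_half_exists u : sp_dom E 2^-1 u -> exists g, sp_pow E 2^-1 u g.
Proof.
by have [l_ [ap _]] := half_steps_exist => du; exact: (sp_pow_exists ap du).
Qed.

(** For the step operators [T] that approximate L^(1/2) this is
    [(f, T (T h)) = (T f, T h)], and [T] composed with itself approximates
    [L]. *)
Lemma sp_pow_half_one f g h k l :
  sp_pow E 2^-1 f g -> sp_pow E 2^-1 h k -> sp_pow E 1 h l ->
  dot f l = dot g k.
Proof.
have half0 : (0 : R) <= 2^-1 by rewrite invr_ge0.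
have [l_ [ap ap1]] := half_steps_exist.
move=> /(sp_pow_cvgL2 ap half0) cf /(sp_pow_cvgL2 ap half0) ch.
move=> /(sp_pow_cvgL2 ap1 ler01) cl.
rewrite dotC (dotC g) -(cvg_lim _ (cvgL2_dotl (v := f) cl))//.
apply/cvg_lim => //; under eq_fun do rewrite step_op_mul.
exact: cvgL2_dot.
Qed.

End given_resolution.

Section operator.
Variable E : spectral_measure Om.
Hypothesis hE : resolves_L E.

Let isL_dot u g w : isL u g -> forall l_ : nat -> step, approximates l_
  (pow_cut 1) ->
  dot (step_op E (l_ n) u) w @[n --> \oo] --> dot g w.
Proof.
move=> /(hE u g) ug l_ ap; exact: (cvgL2_dotl (sp_pow_cvgL2 ap ler01 ug)).
Qed.

Lemma isL_eqL2 u u' g g' : eqL2 u u' -> eqL2 g g' -> isL u g -> isL u' g'.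
Proof.
move=> uu' gg' /hE [du hg]; apply/hE; split; first exact: sp_dom_eqL2 du.
move=> v dv; rewrite -(dot_ae _ gg') hg//; congr (_ * (_ - _)).
  congr fine; apply: eq_measure_integral => A mA _; apply: spmu_eqL2 => //.
  by apply: eqL2_ext => w; rewrite !dotDl (dot_ae _ uu').
congr fine; apply: eq_measure_integral => A mA _; apply: spmu_eqL2 => //.
by apply: eqL2_ext => w; rewrite !dotBl (dot_ae _ uu').
Qed.

Lemma isL_unique u g g' : isL u g -> isL u g' -> eqL2 g g'.
Proof. move=> /hE ug /hE ug'; exact: sp_pow_unique ler01 ug ug'. Qed.

(** Linearity of the domain is immediate for the spectral description, and the
    value follows by testing limits of step operators against any vector. *)
Lemma isL_lin a u v g h : isL u g -> isL v h -> isL (a *: u + v) (a *: g + h).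
Proof.
move=> ug vh; have [l_ [_ ap]] := half_steps_exist.
have [] := (hE _ _).1 ug => du _; have [] := (hE _ _).1 vh => dv _.
have [G /hE uG] := sp_pow_exists ap (sp_domDB (sp_domZ a du) dv).1.
apply: (isL_eqL2 (eqL2_refl _) _ uG); apply: eqL2_ext => w.
rewrite -(cvg_lim _ (isL_dot (w := w) uG ap))//; apply/cvg_lim => //.
under eq_fun do rewrite step_op_sym dotDl dotZl -!step_op_sym.
rewrite dotDl dotZl.
by apply: cvgD; [apply: cvgM; [exact: cvg_cst|]|]; exact: isL_dot ap.
Qed.

Lemma isL_sym u v g h : isL u g -> isL v h -> dot g v = dot u h.
Proof.
move=> ug vh; have [l_ [_ ap]] := half_steps_exist.
rewrite -(cvg_lim _ (isL_dot (w := v) ug ap))//; apply/cvg_lim => //.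
under eq_fun do rewrite step_op_sym dotC.
by rewrite dotC; exact: isL_dot ap.
Qed.

Lemma isL_ge0 u g : isL u g -> 0 <= dot g u.
Proof.
move=> /hE ug; have [l_ [_ ap]] := half_steps_exist.
rewrite -lee_fin -(step_op_cvgL2_form ap (sp_pow_cvgL2 ap ler01 ug)).
by apply: integral_ge0 => x _; rewrite lee_fin pow_cut_ge0.
Qed.

End operator.

(** The bound [|L^(1/2) u| <= C], expressed by duality with D(L) so as not to
    refer to a spectral measure. *)
Definition half_bounded u C : Prop :=
  forall h l, isL h l -> `|dot u l| <= C * Num.sqrt (dot l h).

Lemma half_boundedD u v C D : half_bounded u C -> half_bounded v D ->
  half_bounded (u + v) (C + D).
Proof.
move=> hu hv h l hl; rewrite dotDl mulrDl; apply: le_trans (ler_normD _ _) _.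
by apply: lerD; [exact: hu hl|exact: hv hl].
Qed.

Lemma half_boundedN u C : half_bounded u C -> half_bounded (- u) C.
Proof. by move=> hu h l hl; rewrite dotNl normrN; exact: hu hl. Qed.

Lemma isLpow_half_isL u g l : isLpow 2^-1 u g -> isL u l ->
  dot g g = dot l u.
Proof.
by move=> [E hE ug] /hE ul; rewrite -(sp_pow_half_one ug ug ul) dotC.
Qed.

(** Cauchy-Schwarz in [(u, L h) = (L^(1/2) u, L^(1/2) h)]. *)
Lemma isLpow_half_bounded u g : isLpow 2^-1 u g -> half_bounded u (norm2 g).
Proof.
move=> [E hE ug] h l hl; have /hE hl' := hl.
have [k hk] := sp_pow_half_exists (sp_pow1_dom_half hl').
rewrite (sp_pow_half_one ug hk hl') dotC (_ : dot l h = dot k k).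
  by rewrite -norm2E mulrC dot_norm2_le.
by rewrite -(sp_pow_half_one hk hk hl') dotC.
Qed.

(** Testing the bound on the spectral truncations [h] of [u], for which
    [(u, L h) = (L h, h)], bounds [(L h, h)] by [C ^ 2] uniformly in the
    truncation. *)
Lemma half_bounded_sp_dom E u C : resolves_L E -> half_bounded u C ->
  sp_dom E 2^-1 u.
Proof.
move=> hE hu; have [l_ [_ ap]] := half_steps_exist.
apply/sp_domE.
under eq_integral do rewrite pow_cut_sqr divff ?pnatr_eq0//.
have trunc (N : nat) :
    (\int[sp_mu E u]_(x in `[0%R, N%:R]) (x `^ 1)%:E <= (C ^+ 2)%:E)%E.
  set B := `[0, N%:R]%classic; set h := sp_proj E B u.
  have mB : measurable B by exact: measurable_itv.
  have [l hl] := sp_pow_exists ap (sp_dom_proj_bounded E N u ler01).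
  have cl := sp_pow_cvgL2 ap ler01 hl.
  have e : dot u l = dot l h.
    rewrite dotC -(cvg_lim _ (cvgL2_dotl (v := u) cl))//; apply/cvg_lim => //.
    rewrite (_ : (fun n => _) = (fun n =>
       dot (step_op E (step_mul (l_ n) (l_ n)) h) h)); first exact: cvgL2_dotl.
    apply/funext => n; rewrite !dot_step_op; apply: eq_bigr => p _.
    move: (sval p.2) (svalP p.2) => A mA; congr (_ * _).
    have mAB := measurableI _ _ mA mB; have mBA := measurableI _ _ mB mA.
    have -> : dot (sp_proj E A h) u = dot (sp_proj E (A `&` B) u) u.
      by rewrite proj_dot// /h proj_mulr// setIC.
    by rewrite {2}/h proj_mulr// (proj_dot E h)// /h proj_mulr// setICA setIid.
  have le : dot l h <= C ^+ 2.
    have := hu _ _ ((hE _ _).2 hl); rewrite -/h e.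
    have l0 : 0 <= dot l h by apply: (isL_ge0 hE); exact/hE.
    rewrite ger0_norm// -{1 3}(sqr_sqrtr l0).
    have := sqrtr_ge0 (dot l h); move: (Num.sqrt _) => s.
    rewrite le_eqVlt => /predU1P[<-|s0]; first by rewrite expr0n sqr_ge0.
    rewrite expr2 ler_pM2r// => sC.
    by rewrite ler_pM// ltW.
  apply: (@le_trans _ _ (\int[sp_mu E h]_(x in B) (x `^ 1)%:E)%E).
    rewrite le_eqVlt; apply/orP; left; apply/eqP.
    apply: eq_measure_integral => A mA AB; rewrite spmu_proj//.
    by rewrite (setIidl AB).
  apply: (@le_trans _ _ (\int[sp_mu E h]_(x in `[0%R, +oo[) (x `^ 1)%:E)%E).
    apply: ge0_subset_integral => //.
    - by apply/measurable_EFinP; apply: measurable_funTS;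
      exact: measurable_powR.
    - by move=> x _; rewrite lee_fin powR_ge0.
    - by move=> x /=; rewrite !in_itv/= andbT => /andP[].
  by rewrite integral_pow_cut (step_op_cvgL2_form ap cl) lee_fin.
rewrite -integral_pow_cut itv0y_bigcup; apply: le_lt_trans (ltry (C ^+ 2)).
pose F (N : nat) : set R := `[0, N%:R]%classic.
have ndF : nondecreasing_seq F.
  move=> m n mn; rewrite subsetEset => x; rewrite /F/= !in_itv/=.
  by move=> /andP[-> /le_trans]; apply; rewrite ler_nat.
have mF N : measurable (F N) by exact: measurable_itv.
have mf N : measurable_fun (F N) (fun x : R => (x `^ 1)%:E : \bar R).
  by apply/measurable_EFinP; apply: measurable_funTS; exact: measurable_powR.
have f0 N x : F N x -> (0 <= (x `^ 1)%:E)%E by rewrite lee_fin powR_ge0.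
rewrite -(cvg_lim _ (@ge0_nondecreasing_set_cvg_integral _ _ R F _ _ ndF mF mf
  f0))//.
apply: lime_le; last by apply: nearW => N; exact: trunc.
apply: ereal_nondecreasing_is_cvgn.
exact: (@ge0_nondecreasing_set_nondecreasing_integral _ _ R F _ _ ndF mF mf f0).
Qed.

End half_power.

(** * The form seminorm *)

Section form_seminorm.
Context (R : realType) (Om : convex_domain R).
Implicit Types u v w g h k f : L2 Om.

Lemma norm2_eqL2 u v : eqL2 u v -> norm2 u = norm2 v.
Proof. by move=> e; rewrite !norm2E (dot_ae _ e) (dot_aer _ e). Qed.

Lemma norm2D u v : norm2 (u + v) <= norm2 u + norm2 v.
Proof. exact: ler_LnormD. Qed.

Lemma norm2Z (a : R) u : norm2 (a *: u) = `|a| * norm2 u.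
Proof.
by rewrite !norm2E dotZl dotZr mulrA -expr2 sqrtrM ?sqr_ge0// sqrtr_sqr.
Qed.

Lemma opLP u : domL u -> isL u (opL u).
Proof. by move=> [g ug]; rewrite /opL;
  exact: (@xgetPex _ _ [set g | isL u g]) (ex_intro _ g ug). Qed.

Lemma opLpowP (a : R) u : domLpow a u -> isLpow a u (opLpow a u).
Proof. by move=> [g ug];
  exact: (@xgetPex _ _ [set g | isLpow a u g]) (ex_intro _ g ug). Qed.

Lemma half_bounded_le u (C D : R) : C <= D -> half_bounded u C -> half_bounded
  u D.
Proof.
move=> CD hu h l hl; apply: le_trans (hu h l hl) _.
by rewrite ler_wpM2r// sqrtr_ge0.
Qed.

Section operator.
Variable E : spectral_measure Om.
Hypothesis hE : resolves_L E.

Lemma half_bounded_dom u C : half_bounded u C -> domLpow 2^-1 u.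
Proof.
move=> hu; have [g ug] := sp_pow_half_exists (half_bounded_sp_dom hE hu).
by exists g; exists E.
Qed.

Lemma domL_half u : domL u -> domLpow 2^-1 u.
Proof.
move=> [l /hE ul]; have [g ug] := sp_pow_half_exists (sp_pow1_dom_half ul).
by exists g; exists E.
Qed.

Lemma opL_eq u g : isL u g -> eqL2 (opL u) g.
Proof. by move=> ug; apply: (isL_unique hE _ ug); apply: opLP; exists g. Qed.

Lemma domL_eqL2 u v : eqL2 u v -> domL u -> domL v.
Proof.
by move=> uv [g ug]; exists g; exact: (isL_eqL2 hE uv (eqL2_refl g) ug).
Qed.

Lemma domL_lin a u v : domL u -> domL v -> domL (a *: u + v).
Proof.
by move=> [g ug] [h vh]; exists (a *: g + h); apply: (isL_lin hE).
Qed.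

Lemma domLZ a u : domL u -> domL (a *: u).
Proof.
move=> du; have -> : a *: u = (a - 1) *: u + u by rewrite scalerBl scale1r
  subrK.
exact: domL_lin.
Qed.

Lemma domLB u v : domL u -> domL v -> domL (u - v).
Proof. by move=> du dv; rewrite addrC -scaleN1r; exact: domL_lin. Qed.

Lemma opL_lin a u v : domL u -> domL v ->
  eqL2 (opL (a *: u + v)) (a *: opL u + opL v).
Proof. by move=> du dv; apply: opL_eq; apply: (isL_lin hE); exact: opLP. Qed.

Lemma opL_eqL2 u v : eqL2 u v -> domL u -> eqL2 (opL u) (opL v).
Proof.
move=> uv du; apply: eqL2_sym; apply: opL_eq.
exact: (isL_eqL2 hE uv (eqL2_refl _) (opLP du)).
Qed.

Lemma opL_sym u v : domL u -> domL v -> dot (opL u) v = dot u (opL v).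
Proof. by move=> du dv; apply: (isL_sym hE); exact: opLP. Qed.

(** On D(L) the norm of L^(1/2) u is the form norm, whichever spectral measure
    [opLpow] picks. *)
Lemma half_norm_sqr u : domL u -> norm2 (opLpow 2^-1 u) ^+ 2 = dot (opL u) u.
Proof.
move=> du; rewrite norm2_sqr.
exact: (isLpow_half_isL (opLpowP (domL_half du)) (opLP du)).
Qed.

Lemma half_normE u : domL u ->
  norm2 (opLpow 2^-1 u) = Num.sqrt (dot (opL u) u).
Proof.
by move=> du; rewrite -half_norm_sqr// sqrtr_sqr ger0_norm ?norm2_ge0.
Qed.

Lemma half_norm_eqL2 u v : eqL2 u v -> domL u ->
  norm2 (opLpow 2^-1 u) = norm2 (opLpow 2^-1 v).
Proof.
move=> uv du; rewrite !half_normE//; last exact: domL_eqL2 uv du.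
by rewrite (dot_ae _ (opL_eqL2 uv du)) (dot_aer _ uv).
Qed.

Lemma half_norm_CS u v : domL u -> domL v ->
  `|dot (opL u) v| <= norm2 (opLpow 2^-1 u) * norm2 (opLpow 2^-1 v).
Proof.
move=> du dv; rewrite opL_sym// (half_normE dv).
exact: (isLpow_half_bounded (opLpowP (domL_half du)) (opLP dv)).
Qed.

Lemma half_normZD a u v : domL u -> domL v ->
  norm2 (opLpow 2^-1 (a *: u + v)) <=
  `|a| * norm2 (opLpow 2^-1 u) + norm2 (opLpow 2^-1 v).
Proof.
move=> du dv; set s := norm2 (opLpow _ u); set t := norm2 (opLpow _ v).
have s0 : 0 <= s by exact: norm2_ge0.
have t0 : 0 <= t by exact: norm2_ge0.
rewrite -(@ler_pXn2r _ 2) ?nnegrE ?addr_ge0 ?mulr_ge0 ?norm2_ge0//.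
rewrite half_norm_sqr; last exact: domL_lin.
rewrite (dot_ae _ (opL_lin a du dv)) !dotE -!half_norm_sqr// -/s -/t.
rewrite [dot (opL v) u]opL_sym// (dotC v) sqrrD exprMn real_normK ?num_real//.
have := half_norm_CS du dv; rewrite -/s -/t => cs.
have : a * dot (opL u) v <= `|a| * (s * t).
  apply: le_trans (ler_norm _) _; rewrite normrM.
  exact: ler_wpM2l.
rewrite mulr2n mulrDr; lra.
Qed.

(** The bound at [t] propagates to a neighbourhood by continuity, and
    compactness of the time interval makes it uniform. *)
Lemma half_bounded_uniform (T : R) (F : R -> L2 Om) : 0 < T ->
  continuous_domLpow 2^-1 T F ->
  exists2 C, 0 <= C & forall t, t \in `[0, T] -> half_bounded (F t) C.
Proof.
move=> T0 [domF cF].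
have hF t : t \in `[0, T] -> half_bounded (F t) (norm2 (opLpow 2^-1 (F t))).
  by move=> tT; apply: isLpow_half_bounded; apply: opLpowP; exact: domF.
have hd s t : s \in `[0, T] -> t \in `[0, T] ->
    half_bounded (F s) (norm2 (opLpow 2^-1 (F s - F t)) + norm2 (opLpow 2^-1 (F
      t))).
  move=> sT tT.
  suff /half_boundedD/(_ (hF t tT)) :
    half_bounded (F s - F t) (norm2 (opLpow 2^-1 (F s - F t))) by rewrite subrK.
  apply: isLpow_half_bounded; apply: opLpowP; apply: half_bounded_dom.
  exact: half_boundedD (hF s sT) (half_boundedN (hF t tT)).
have /compact_near_coveringP/near_covering_withinP := @segment_compact R 0 T.
move=> /(_ R (pinfty_nbhs R) (fun C s => half_bounded (F s) C) _) h.
have : \forall C \near +oo, `[0, T]%classic `<=` (fun s => half_bounded (F s)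
  C).
  apply: h => t /= tT.
  have [_ /cvgrPdist_lt/(_ 1 ltr01)] := cF t tT.
  rewrite near_withinE => nt.
  near=> s C => /= sT.
  apply: half_bounded_le (hd s t sT tT).
  apply: (@le_trans _ _ (1 + norm2 (opLpow 2^-1 (F t)))).
    rewrite lerD2r; have : `[0, T]%classic s -> `|0 - norm2 (opLpow 2^-1 (F s -
      F t))| < 1.
      by near: s.
    by move=> /(_ sT); rewrite sub0r normrN ger0_norm ?norm2_ge0// => /ltW.
  by near: C; apply: nbhs_pinfty_ge; exact: num_real.
move=> [M [_ hM]]; exists (`|M| + 1); first by rewrite addr_ge0.
move=> t tT; apply: hM => //.
by rewrite (le_lt_trans (ler_norm M))// ltrDl.
Unshelve. all: by end_near. Qed.

End operator.
End form_seminorm.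

(** * Energy bounds for the scheme *)

Section scheme_bounds.
Context (R : realType) (Om : convex_domain R) (E : spectral_measure Om).
Hypothesis hE : resolves_L E.
Implicit Types u v w : L2 Om.

Local Notation hn u := (norm2 (opLpow 2^-1 u)).

(** Pairing the scheme with [L (up - um)]: the difference quotients telescope
    in the form seminorm, the operator terms in the norm of [L u]. *)
Lemma scheme_step_energy (alpha beta : R -> R) (f : R -> L2 Om)
    (tau t F : R) um u up :
  0 < tau -> domL um -> domL u -> domL up -> half_bounded (f t) F -> 0 <= F ->
  scheme_step alpha beta f tau t um u up ->
  hn (tau^-1 *: (up - u)) ^+ 2 - hn (tau^-1 *: (u - um)) ^+ 2
    + (alpha t + beta t / 2 * (hn up ^+ 2 + hn um ^+ 2)) / 2
      * (norm2 (opL up) ^+ 2 - norm2 (opL um) ^+ 2)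
  <= tau * (F * (hn (tau^-1 *: (up - u)) + hn (tau^-1 *: (u - um)))).
Proof.
move=> tau0 dum du dup hF F0 st.
set d1 := tau^-1 *: (up - u); set d0 := tau^-1 *: (u - um).
have tn0 : tau != 0 by rewrite gt_eqF.
have dd1 : domL d1 by apply: (domLZ hE); exact: (domLB hE).
have dd0 : domL d0 by apply: (domLZ hE); exact: (domLB hE).
have dd : domL (d1 + d0) by rewrite -[d1]scale1r; exact: (domL_lin hE).
have upE : up = um + tau *: (d1 + d0).
  by rewrite scalerDr /d1 /d0 !scalerA mulfV// !scale1r addrC subrKA subrK.
set W := opL (d1 + d0); set X := opL up - opL um.
have XW v : dot v X = tau * dot v W.
  have e : up = tau *: (d1 + d0) + um by rewrite {1}upE addrC.
  rewrite dotBr (dot_aer v (_ : eqL2 (opL up) (tau *: W + opL um))).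
    by rewrite !dotE addrK.
  by rewrite {1}e; exact: (opL_lin hE).
have := dot_ae X st; rewrite dotDl dotZl (dotZl (2^-1 * _)) dotDl (dotBl _ (2
  *: u)).
rewrite dotZl.
have -> : dot (opL up + opL um) X = norm2 (opL up) ^+ 2 - norm2 (opL um) ^+ 2.
  by rewrite dotDB !norm2_sqr.
rewrite !XW.
have dW : dot d1 W - dot d0 W = hn d1 ^+ 2 - hn d0 ^+ 2.
  have e v : dot v W = dot v (opL d1) + dot v (opL d0).
    rewrite -dotDr; apply: dot_aer; rewrite /W -{1}[d1]scale1r.
    by apply: eqL2_trans (opL_lin hE 1 dd1 dd0) _; rewrite scale1r;
      exact: eqL2_refl.
  rewrite !e !(half_norm_sqr hE)// -(opL_sym hE dd1 dd0).
  by rewrite (dotC d1 (opL d1)) !(dotC d0); ring.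
have quot : tau ^- 2 * (tau * dot up W - 2 * (tau * dot u W) + tau * dot um W) =
    dot d1 W - dot d0 W.
  by rewrite /d1 /d0 !dotZl !dotBl; field.
rewrite quot dW => h.
have fW : dot (f t) W <= F * (hn d1 + hn d0).
  apply: le_trans (ler_norm _) _; apply: le_trans (hF _ _ (opLP dd)) _.
  apply: ler_wpM2l => //; rewrite -(half_normE hE dd).
  have := half_normZD hE 1 dd1 dd0.
  by rewrite scale1r normr1 mul1r.
by have := ler_wpM2l (ltW tau0) fW; rewrite -h [2^-1 * _]mulrC.
Qed.

(** The constants involve only the data. The terms with [w0] are meaningful
    because the existence of a solution, whose second term lies in D(L), places
    [w0] in D(L). *)
Lemma solution_discrete_bound (T a0 a1 A B b1 F : R) (alpha beta : R -> R)
    (f : R -> L2 Om) (u0 v0 : L2 Om) (n : nat) (u : nat -> L2 Om) :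
  0 < T -> 0 <= F ->
  (forall t, t \in `[0, T] -> a0 <= alpha t <= a1) ->
  (forall t, t \in `[0, T] -> 0 <= beta t <= b1) ->
  (forall s t, s \in `[0, T] -> t \in `[0, T] ->
     `|alpha t - alpha s| <= A * `|t - s|) ->
  (forall s t, s \in `[0, T] -> t \in `[0, T] ->
     `|beta t - beta s| <= B * `|t - s|) ->
  (forall t, t \in `[0, T] -> half_bounded (f t) F) ->
  domL v0 -> (1 < n)%N -> solution_sequence T alpha beta f u0 v0 n u ->
  let tau := T / n%:R in
  let w := w0 alpha beta f u0 in
  discrete_bound n tau a0 a1 A B b1 F
    (hn v0 + T * hn w)
    (norm2 (opL u0) + T * norm2 (opL v0) + T ^+ 2 * norm2 (opL w)) (hn u0)
    (fun k => alpha (k%:R * tau)) (fun k => beta (k%:R * tau))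
    (fun k => hn (tau^-1 *: (u k - u k.-1))) (fun k => norm2 (opL (u k)))
    (fun k => hn (u k)).
Proof.
move=> T0 F0 hal hbe lal lbe hf dv0 n1 [du eu0 eu1 st] tau w.
have n0 : (0 < n)%N by exact: ltnW.
have nR : 0 < n%:R :> R by rewrite ltr0n.
have tau0 : 0 < tau by rewrite divr_gt0.
have tn0 : tau != 0 by rewrite gt_eqF.
have tauT : tau <= T by rewrite ler_pdivrMr// ler_peMr ?ler1n// ltW.
have tI k : (k <= n)%N -> k%:R * tau \in `[0, T].
  move=> kn; rewrite in_itv/= mulr_ge0 ?(ltW tau0)//=.
  by rewrite /tau mulrA ler_pdivrMr// mulrC ler_pM2l// ler_nat.
have tS k : `|k.+1%:R * tau - k%:R * tau| = tau.
  by rewrite -mulrBl -natr1 addrC addKr mul1r ger0_norm// ltW.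
have dq k j : (k <= n)%N -> (j <= n)%N -> domL (tau^-1 *: (u k - u j)).
  by move=> kn jn; apply: (domLZ hE); apply: (domLB hE); exact: du.
have du0 : domL u0 by apply: (domL_eqL2 hE eu0); exact: du.
move: eu1; rewrite /first_step -/w -/tau => eu1; move: (w) eu1 => {}w eu1.
have dv : domL (tau *: v0 + u0) by exact: (domL_lin hE).
(* Solve the first step for the acceleration. *)
have dw : domL w.
  apply: (domL_eqL2 hE (_ : eqL2 ((2 / tau ^+ 2) *: (u 1%N - (tau *: v0 + u0)))
    w)).
    apply: eqL2_ext => x; rewrite dotZl dotBl (dot_ae x eu1) !dotE.
    by field.
  by apply: (domLZ hE); apply: (domLB hE) => //; exact: du.
have eu1' : eqL2 (u 1%N) ((tau ^+ 2 / 2) *: w + (tau *: v0 + u0)).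
  by apply: eqL2_trans eu1 _; rewrite addrC (addrC u0); exact: eqL2_refl.
split => //.
- by move=> k; exact: norm2_ge0.
- by move=> k; exact: norm2_ge0.
- by move=> k; exact: norm2_ge0.
- by move=> k kn; apply: hal; exact: tI.
- by move=> k kn; apply: hbe; exact: tI.
- move=> k kn; rewrite -[in leRHS](tS k); apply: lal; apply: tI => //;
  exact: ltnW.
- move=> k kn; rewrite -[in leRHS](tS k); apply: lbe; apply: tI => //;
  exact: ltnW.
- have aux (a b c : R) : a <= c + b -> b <= c + a -> `|a - b| <= c.
    by move=> h1 h2; rewrite ler_norml; apply/andP; split; lra.
  move=> k kn /=; set d := tau^-1 *: (u k.+1 - u k).
  have dd : domL d by apply: dq => //; exact: ltnW.
  have dk : domL (u k) by apply: du; exact: ltnW.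
  have dk1 : domL (u k.+1) by exact: du.
  have e : tau *: d = u k.+1 - u k by rewrite scalerA mulfV// scale1r.
  have := half_normZD hE tau dd dk; rewrite e subrK.
  have := half_normZD hE (- tau) dd dk1; rewrite scaleNr e opprB subrK normrN.
  rewrite (gtr0_norm tau0) => h1 h2.
  exact: aux h2 h1.
- move=> k /andP[k1 kn].
  apply: (scheme_step_energy tau0 _ _ _ _ F0 (st k _)).
  + by apply: du; exact: leq_trans (leq_pred _) (ltnW kn).
  + by apply: du; exact: ltnW.
  + exact: du.
  + by apply: hf; apply: tI; exact: ltnW.
  + by rewrite k1.
- have e : eqL2 (tau^-1 *: (u 1%N - u 0%N)) ((tau / 2) *: w + v0).
    apply: eqL2_ext => x.
    by rewrite dotZl dotBl (dot_ae x eu1') (dot_ae x eu0) !dotE; field.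
  rewrite /= (half_norm_eqL2 hE e); last exact: dq.
  apply: le_trans (half_normZD hE (tau / 2) dw dv0) _.
  rewrite addrC lerD2l ler_wpM2r ?norm2_ge0// gtr0_norm ?divr_gt0//; lra.
- rewrite (norm2_eqL2 (opL_eqL2 hE eu0 (du 0%N (leq0n n)))) -addrA lerDl.
  by rewrite addr_ge0 ?mulr_ge0 ?norm2_ge0 ?sqr_ge0// ltW.
- rewrite (norm2_eqL2 (opL_eqL2 hE eu1' (du _ n0))).
  rewrite (norm2_eqL2 (opL_lin hE _ dw dv)).
  apply: le_trans (norm2D _ _) _; rewrite addrC lerD//.
    rewrite (norm2_eqL2 (opL_lin hE _ dv0 du0)) addrC.
    apply: le_trans (norm2D _ _) _; rewrite lerD2l norm2Z gtr0_norm//.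
    by rewrite ler_wpM2r ?norm2_ge0.
  rewrite norm2Z ler_wpM2r ?norm2_ge0// ger0_norm ?divr_ge0 ?sqr_ge0//.
  apply: (@le_trans _ _ (tau ^+ 2)); first by have := sqr_ge0 tau; lra.
  by rewrite ler_pXn2r ?nnegrE// ltW.
- by rewrite (half_norm_eqL2 hE eu0) //; exact: du.
Qed.

End scheme_bounds.

Theorem lemma4p3 (R : realType) (Om : convex_domain R) (T : R)
    (alpha beta : R -> R) (f : R -> L2 Om) (u0 v0 : L2 Om) :
  0 < T ->
  C1_itv T alpha -> C1_itv T beta ->
  {in `[0, T], forall t, 0 < alpha t} ->
  {in `[0, T], forall t, 0 < beta t} ->
  domLpow 2 u0 -> domL v0 ->
  continuous_domLpow 2^-1 T f -> domL (f 0) ->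
  exists Tbar M3 M4 : R,
    [/\ 0 < Tbar <= T, 0 < M3, 0 < M4 &
      forall (n : nat) (u : nat -> L2 Om),
        let tau := T / n%:R in
        (1 < n)%N -> solution_sequence T alpha beta f u0 v0 n u ->
        forall k, (1 <= k <= Num.truncn (Tbar / tau))%N ->
          norm2 (opLpow 2^-1 (tau^-1 *: (u k - u k.-1))) <= M3 /\
          norm2 (opL (u k)) <= M4].
Proof.
move=> T0 C1a C1b pa pb [_ [E hE _]] dv0 cf _.
have [a0 a00 ha0] := segment_pos_lower T0 C1a.1 pa.
have [a1 a10 ha1] := segment_bounded T0 C1a.1.
have [b1 b10 hb1] := segment_bounded T0 C1b.1.
have [A A0 lA] := C1_itv_lipschitz T0 C1a.
have [B B0 lB] := C1_itv_lipschitz T0 C1b.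
have [F F0 hF] := half_bounded_uniform hE T0 cf.
pose w := w0 alpha beta f u0.
have [Tbar [M [TbarT M0 hM]]] := discrete_bound_local
  (norm2 (opLpow 2^-1 v0) + T * norm2 (opLpow 2^-1 w))
  (norm2 (opL u0) + T * norm2 (opL v0) + T ^+ 2 * norm2 (opL w))
  T0 a00 (ltW a10) (ltW A0) (ltW B0) (ltW b10) F0 (norm2_ge0 (opLpow 2^-1 u0)).
exists Tbar, M, M; split=> // n u tau n1 sol k /andP[k1 kT].
have nR : 0 < n%:R :> R by rewrite ltr0n ltnW.
have tau0 : 0 < tau by rewrite divr_gt0.
have [Tbar0 TbarT'] := andP TbarT.
have kTbar : k%:R * tau <= Tbar.
  move: kT; rewrite truncn_ge_nat; last by rewrite divr_ge0// ltW.
  by rewrite ler_pdivlMr.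
have nT : n%:R * tau = T by rewrite /tau mulrC divfK// gt_eqF.
have kn : (1 <= k <= n)%N.
  rewrite k1/= -(ler_nat R) -(ler_pM2r tau0) nT.
  exact: le_trans TbarT'.
have ha t : t \in `[0, T] -> a0 <= alpha t <= a1.
  by move=> tT; rewrite ha0//= (le_trans (ler_norm _))//; exact: ha1.
have hb t : t \in `[0, T] -> 0 <= beta t <= b1.
  by move=> tT; rewrite ltW ?pb//= (le_trans (ler_norm _))//; exact: hb1.
have db := solution_discrete_bound hE T0 F0 ha hb lA lB hF dv0 n1 sol.
exact: (hM _ _ _ _ _ _ _ db tau0 nT k kn kTbar).
Qed.
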